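(* Let $G$ be a finite group, let $A$ be a finite $G$-set, let $H\le G$ be a subgroup, and let $\downarrow^G_H\! A$ denote the restriction of $A$ to an $H$-set. Then $$|\mathcal P(A)|^H\simeq |\mathcal P^H(\downarrow^G_H\! A)|,$$ and this space is non-contractible only if there are a subgroup $K\le H$ and an integer $n$ such that $\downarrow^G_H\! A\cong\coprod_{i=1}^n H/K$ as $H$-sets.
   Context: $|\mathcal C|$ is the classifying space (geometric realization of the nerve) of $\mathcal C$, and $X^H$ denotes $H$-fixed points. $\mathcal P(A)$ is the poset of partitions of the underlying set of $A$, excluding the discrete partition (all blocks singletons) and the indiscrete partition (one block), ordered by coarsening ($\lambda\le\mu$ if every block of $\lambda$ lies in a block of $\mu$). A partition is an equivalence class of surjections $q\colon A\twoheadrightarrow\{1,\dots,k\}$ modulo $\Sigma_k$, and $g\in G$ acts by sending $q$ to $q\circ g^{-1}$. For a finite $H$-set $X$, $\mathcal P^H(X)$ is the poset of equivalence classes of $H$-equivariant surjections $X\twoheadrightarrow B$ onto $H$-sets (modulo $H$-isomorphisms of the target), excluding $H$-isomorphisms and the constant map to a point, with $[X\twoheadrightarrow B']\le[X\twoheadrightarrow B]$ when the latter factors as $X\twoheadrightarrow B'\twoheadrightarrow B$ through $H$-maps. The empty space is not contractible. *)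

(* Defs.v *)
From HB Require Import structures.
From Stdlib Require Import Relation_Operators.
From mathcomp Require Import all_boot all_order all_algebra all_fingroup.
From mathcomp Require Import all_classical all_reals topology normedtype.

Set Implicit Arguments.
Unset Strict Implicit.
Unset Printing Implicit Defensive.

Import Order.TTheory GRing.Theory Num.Theory GroupScope.
Import numFieldNormedType.Exports.

Local Open Scope classical_set_scope.
Local Open Scope ring_scope.
Local Open Scope quotient_scope.

Definition homotopic (R : realType) (X Y : topologicalType) (f g : X -> Y) :
    Prop :=
  exists F : X * R -> Y,
    [/\ {within [set: X] `*` `[0, 1], continuous F},
        forall x, F (x, 0) = f x & forall x, F (x, 1) = g x].

Definition homotopy_equivalent (R : realType) (X Y : topologicalType) : Prop :=
  exists (f : X -> Y) (g : Y -> X),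
    [/\ continuous f, continuous g,
        homotopic R (g \o f) id & homotopic R (f \o g) id].

(* The base point x0 makes the empty space non-contractible. *)
Definition contractible (R : realType) (X : topologicalType) : Prop :=
  exists x0 : X, homotopic R (@id X) (fun=> x0).

Definition simplex (R : realType) (n : nat) : set 'rV[R]_n.+1 :=
  [set t | (forall i, 0 <= t ord0 i) /\ \sum_i t ord0 i = 1].

Arguments simplex : clear implicits.

Lemma simplex_push_subproof (R : realType) (m n : nat)
    (th : 'I_m.+1 -> 'I_n.+1) (t : simplex R m) :
  (\row_j \sum_(i | th i == j) (val t) ord0 i) \in simplex R n.
Proof.
case: t => t /= /set_mem[t0 t1]; apply/mem_set; split=> [j|].
  by rewrite mxE; apply: sumr_ge0 => i _; exact: t0.
under eq_bigr do rewrite mxE.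
by rewrite -t1 [RHS](partition_big th predT).
Qed.

Definition simplex_push (R : realType) (m n : nat) (th : 'I_m.+1 -> 'I_n.+1)
    (t : simplex R m) : simplex R n :=
  exist (fun u => u \in simplex R n) _ (simplex_push_subproof th t).

Definition nerve (d : Order.disp_t) (P : porderType d) (n : nat) : choiceType :=
  {c : {ffun 'I_n.+1 -> P} |
    [forall i : 'I_n.+1, forall j : 'I_n.+1, (i <= j)%N ==> (c i <= c j)%O]}.

Lemma nerve_mono (d : Order.disp_t) (P : porderType d) (n : nat)
    (c : nerve P n) :
  {homo val c : i j / (i <= j)%N >-> (i <= j)%O}.
Proof. by case: c => c /= /'forall_'forall_implyP; apply. Qed.

Lemma nerve_pull_subproof (d : Order.disp_t) (P : porderType d) (m n : nat)
    (th : 'I_m.+1 -> 'I_n.+1)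
    (th_mono : {homo th : i j / (i <= j)%N}) (c : nerve P n) :
  [forall i : 'I_m.+1, forall j : 'I_m.+1,
    (i <= j)%N ==> ([ffun k => val c (th k)] i <= [ffun k => val c (th k)] j)%O].
Proof.
by apply/'forall_'forall_implyP => i j ij; rewrite !ffunE nerve_mono ?th_mono.
Qed.

Definition nerve_pull (d : Order.disp_t) (P : porderType d) (m n : nat)
    (th : 'I_m.+1 -> 'I_n.+1) (th_mono : {homo th : i j / (i <= j)%N})
    (c : nerve P n) : nerve P m :=
  exist _ [ffun k => val c (th k)] (nerve_pull_subproof th_mono c).

Lemma nerve_map_subproof (d d' : Order.disp_t) (P : porderType d)
    (Q : porderType d') (f : P -> Q) (f_mono : {homo f : x y / (x <= y)%O})
    (n : nat) (c : nerve P n) :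
  [forall i : 'I_n.+1, forall j : 'I_n.+1,
    (i <= j)%N ==> ([ffun k => f (val c k)] i <= [ffun k => f (val c k)] j)%O].
Proof.
by apply/'forall_'forall_implyP => i j ij; rewrite !ffunE f_mono ?nerve_mono.
Qed.

Definition nerve_map (d d' : Order.disp_t) (P : porderType d)
    (Q : porderType d') (f : P -> Q) (f_mono : {homo f : x y / (x <= y)%O})
    (n : nat) (c : nerve P n) : nerve Q n :=
  exist _ [ffun k => f (val c k)] (nerve_map_subproof f_mono c).

Section Realization.
Variables (R : realType) (d : Order.disp_t) (P : porderType d).

(* The disjoint union over n of nerve P n * simplex R n, nerve P n being
   discrete *)
Definition cells : topologicalType :=
  {s : {n : nat & nerve P n} & simplex R (tag s)}.

Definition cell (n : nat) (c : nerve P n) (t : simplex R n) : cells :=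
  existT (fun s : {n : nat & nerve P n} => simplex R (tag s))
         (existT (nerve P) n c) t.

Inductive glue : cells -> cells -> Prop :=
  Glue (m n : nat) (th : 'I_m.+1 -> 'I_n.+1)
    (th_mono : {homo th : i j / (i <= j)%N}) (c : nerve P n) (t : simplex R m) :
  glue (cell (nerve_pull th_mono c) t) (cell c (simplex_push th t)).

Definition glued : rel cells := fun x y => `[< clos_refl_sym_trans _ glue x y >].

Lemma glued_refl : reflexive glued.
Proof. by move=> x; apply/asboolP; exact: rst_refl. Qed.

Lemma glued_sym : symmetric glued.
Proof. by move=> x y; apply/asboolP/asboolP; exact: rst_sym. Qed.

Lemma glued_trans : transitive glued.
Proof.
by move=> y x z /asboolP xy /asboolP yz; apply/asboolP; exact: rst_trans xy yz.
Qed.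

Canonical glued_equiv := EquivRel glued glued_refl glued_sym glued_trans.

Definition realization : topologicalType :=
  quotient_topology {eq_quot glued_equiv}.

Definition to_realization (x : cells) : realization :=
  \pi_(quotient_topology {eq_quot glued_equiv}) x.

Definition of_realization (x : realization) : cells :=
  @generic_quotient.repr cells (quotient_topology {eq_quot glued_equiv}) x.

Lemma of_realizationK : cancel of_realization to_realization.
Proof. exact: reprK. Qed.

Lemma to_realizationP (x y : cells) :
  clos_refl_sym_trans _ glue x y <-> to_realization x = to_realization y.
Proof.
rewrite /to_realization; split.
  by move=> xy; apply/(@eqmodP _ glued_equiv); apply/asboolP.
by move=> /(@eqmodP _ glued_equiv) /asboolP.
Qed.

End Realization.

Arguments glue {R d P}.

Section RealizationMap.
Variables (R : realType) (d d' : Order.disp_t).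
Variables (P : porderType d) (Q : porderType d') (f : P -> Q).
Hypothesis f_mono : {homo f : x y / (x <= y)%O}.

Definition cells_map (x : cells R P) : cells R Q :=
  cell (nerve_map f_mono (tagged (tag x))) (tagged x).

Lemma glue_map (x y : cells R P) :
  glue x y -> glue (cells_map x) (cells_map y).
Proof.
case=> m n th th_mono c t; rewrite /cells_map /=.
suff -> : nerve_map f_mono (nerve_pull th_mono c) =
          nerve_pull th_mono (nerve_map f_mono c) by exact: Glue.
by apply: val_inj; apply/ffunP => k; rewrite /= !ffunE.
Qed.

Definition realization_map (x : realization R P) : realization R Q :=
  to_realization (cells_map (of_realization x)).

Lemma glued_map (x y : cells R P) :
  clos_refl_sym_trans _ glue x y ->
  clos_refl_sym_trans _ glue (cells_map x) (cells_map y).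
Proof.
elim=> [{}x {}y xy|{}x|{}x {}y _|{}x {}y z _ + _].
- by apply: rst_step; exact: glue_map.
- exact: rst_refl.
- exact: rst_sym.
- exact: rst_trans.
Qed.

(* independence of the chosen representative *)
Lemma realization_mapE (x : cells R P) :
  realization_map (to_realization x) = to_realization (cells_map x).
Proof.
apply/to_realizationP; apply: glued_map.
by apply/to_realizationP; rewrite of_realizationK.
Qed.

End RealizationMap.

Section Partitions.
Local Close Scope classical_set_scope.
Local Open Scope set_scope.
Variable A : finType.

Definition proper_partition_pred (l : {set {set A}}) : bool :=
  [&& finset.partition l [set: A],
      ~~ [forall B in l, #|B| == 1%N] & #|l| != 1%N].

Record proper_partition := ProperPartition {
  blocks :> {set {set A}};
  blocksP : proper_partition_pred blocks }.

HB.instance Definition _ := [isSub for blocks].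
HB.instance Definition _ := [Finite of proper_partition by <:].

Definition coarsening (l m : proper_partition) : bool :=
  [forall B in blocks l, [exists C in blocks m, B \subset C]].

Lemma coarseningP (l m : proper_partition) :
  reflect (forall B, B \in blocks l -> exists2 C, C \in blocks m & B \subset C)
          (coarsening l m).
Proof. exact: 'forall_in_exists_inP. Qed.

Lemma coarsening_refl : reflexive coarsening.
Proof. by move=> l; apply/coarseningP => B Bl; exists B. Qed.

Lemma coarsening_sub (l m : proper_partition) :
  coarsening l m -> coarsening m l -> blocks l \subset blocks m.
Proof.
move=> /coarseningP lm /coarseningP ml; apply/fintype.subsetP => B Bl.
have [C Cm BC] := lm _ Bl; have [B' B'l CB'] := ml _ Cm.
have /and3P[pl _ _] := blocksP l.
have /set0Pn[x xB] := finset.partition_neq0 pl Bl.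
have xB' : x \in B' by rewrite (fintype.subsetP CB') ?(fintype.subsetP BC).
have BB' : B = B'.
  by rewrite -(def_pblock (finset.partition_trivIset pl) Bl xB)
             -(def_pblock (finset.partition_trivIset pl) B'l xB').
by rewrite (_ : B = C) //; apply/eqP; rewrite finset.eqEsubset BC BB' CB'.
Qed.

Lemma coarsening_anti : antisymmetric coarsening.
Proof.
move=> l m /andP[lm ml]; apply: val_inj; apply/eqP.
by rewrite finset.eqEsubset !coarsening_sub.
Qed.

Lemma coarsening_trans : transitive coarsening.
Proof.
move=> m l k /coarseningP lm /coarseningP mk; apply/coarseningP => B /lm[C Cm BC].
by have [D Dk CD] := mk _ Cm; exists D => //; exact: fintype.subset_trans BC CD.
Qed.

HB.instance Definition _ := Order.Le_isPOrder.Build (Order.Disp tt tt)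
  proper_partition coarsening_refl coarsening_anti coarsening_trans.

End Partitions.

Section PartitionAction.
Local Close Scope classical_set_scope.
Local Open Scope set_scope.
Variables (gT : finGroupType) (G : {group gT}) (A : finType) (to : action G A).

Definition blocks_act (l : {set {set A}}) (g : gT) : {set {set A}} :=
  [set [set to x g | x in (B : {set A})] | B in l].

(* Actions are right actions here, so the map q o g^-1 is
   x |-> q (to x g^-1). *)
Lemma blocks_act_preim (T : eqType) (q : A -> T) (g : gT) : g \in G ->
  blocks_act (preim_partition q [set: A]) g =
  preim_partition (fun x => q (to x g^-1%g)) [set: A].
Proof.
move=> gG; have toK := actKin to gG; have toVK := actKVin to gG.
have blockE x : [set to y g | y in [set y in [set: A] | q x == q y]] =
    [set y in [set: A] | q (to (to x g) g^-1%g) == q (to y g^-1%g)].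
  apply/setP => z; rewrite toK !inE /=; apply/imsetP/idP => [[y + ->]|qz].
    by rewrite !inE toK.
  by exists (to z g^-1%g); rewrite ?toVK ?inE.
apply/setP => B; apply/imsetP/imsetP => [[_ /imsetP[x _ ->] ->]|[x _ ->]].
  by exists (to x g); rewrite ?inE // blockE.
exists [set y in [set: A] | q (to x g^-1%g) == q y].
  by apply/imsetP; exists (to x g^-1%g); rewrite ?inE.
by rewrite blockE toVK.
Qed.

Lemma proper_partition_act_subproof (l : proper_partition A) (g : gT) :
  proper_partition_pred (blocks_act (blocks l) g).
Proof.
have injg : injective (to^~ g) by exact: act_inj.
have /and3P[pl nd ni] := blocksP l; apply/and3P; split.
- have -> : [set: A] = (to^~ g) @: [set: A].
    by apply/esym/eqP; rewrite eqEcard finset.subsetT (card_imset _ injg) leqnn.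
  by rewrite finset.imset_partition.
- apply: contra nd => /forall_inP d; apply/forall_inP => B Bl.
  by rewrite -(card_imset B injg); apply: d; apply: imset_f.
- by rewrite card_imset //; exact: imset_inj.
Qed.

Definition proper_partition_act (g : gT) (l : proper_partition A) :
  proper_partition A := ProperPartition (proper_partition_act_subproof l g).

Lemma proper_partition_act_mono (g : gT) :
  {homo proper_partition_act g : l m / (l <= m)%O}.
Proof.
move=> l m /coarseningP lm; apply/coarseningP => _ /imsetP[B /lm[C Cm BC] ->].
by exists [set to x g | x in C]; [exact: imset_f|exact: imsetS].
Qed.

End PartitionAction.

Definition fixed_realization (R : realType) (gT : finGroupType)
    (G : {group gT}) (A : finType) (to : action G A) (H : {set gT}) :
    topologicalType :=
  set_type [set x : realization R (proper_partition A) |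
    forall h, h \in H ->
      realization_map (@proper_partition_act_mono _ _ _ to h) x = x].

Definition equivariant (gT : finGroupType) (H : {set gT}) (X Y : Type)
    (toX : action H X) (toY : action H Y) (f : X -> Y) : Prop :=
  forall x h, h \in H -> f (toX x h) = toY (f x) h.

Section EquivariantPartitions.
Variables (gT : finGroupType) (H : {set gT}) (X : finType) (to : action H X).

(* Every finite H-set is isomorphic to one carried by some 'I_k, so these
   represent all isomorphism classes of surjections onto H-sets. An H-map is
   an H-isomorphism if and only if it is bijective. *)
Record hsurj := HSurj {
  hs_size : nat;
  hs_act : action H 'I_hs_size;
  hs_fun : X -> 'I_hs_size;
  hs_equivariant : equivariant to hs_act hs_fun;
  hs_surj : forall b, exists x, hs_fun x = b;
  hs_not_iso : ~ bijective hs_fun;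
  hs_not_point : hs_size <> 1%N }.

HB.instance Definition _ := gen_eqMixin hsurj.
HB.instance Definition _ := gen_choiceMixin hsurj.

Definition hs_factor (q' q : hsurj) : Prop :=
  exists2 f : 'I_(hs_size q') -> 'I_(hs_size q),
    equivariant (hs_act q') (hs_act q) f & hs_fun q =1 f \o hs_fun q'.

Definition hs_isom (q' q : hsurj) : Prop :=
  exists f : 'I_(hs_size q') -> 'I_(hs_size q),
    [/\ equivariant (hs_act q') (hs_act q) f, bijective f &
        hs_fun q =1 f \o hs_fun q'].

Lemma hs_factor_refl q : hs_factor q q.
Proof. by exists id. Qed.

Lemma hs_factor_trans q2 q1 q3 :
  hs_factor q1 q2 -> hs_factor q2 q3 -> hs_factor q1 q3.
Proof.
move=> [f fE fq] [g gE gq]; exists (g \o f) => [b h hH|x] /=.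
  by rewrite fE // gE.
by rewrite gq /= fq.
Qed.

Lemma hs_isom_factor q1 q2 : hs_isom q1 q2 <-> hs_factor q1 q2 /\ hs_factor q2 q1.
Proof.
split.
  move=> [f [fE [g fK gK] fq]]; split; first by exists f.
  exists g => [b h hH|x] /=; last by rewrite fq /= fK.
  by rewrite -{1}(gK b) -fE // fK.
move=> [[f fE fq] [g gE gq]]; exists f; split=> //.
by exists g => b; have [x <-] := hs_surj b;
  [rewrite -[f _]fq -[g _]gq | rewrite -[g _]gq -[f _]fq].
Qed.

Definition hs_isomb : rel hsurj := fun q q' => `[< hs_isom q q' >].

Lemma hs_isomb_refl : reflexive hs_isomb.
Proof.
by move=> q; apply/asboolP/hs_isom_factor; split; exact: hs_factor_refl.
Qed.

Lemma hs_isomb_sym : symmetric hs_isomb.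
Proof.
by move=> q q'; apply/asboolP/asboolP => /hs_isom_factor[? ?];
  apply/hs_isom_factor.
Qed.

Lemma hs_isomb_trans : transitive hs_isomb.
Proof.
move=> q2 q1 q3 /asboolP/hs_isom_factor[a b] /asboolP/hs_isom_factor[c d].
by apply/asboolP/hs_isom_factor; split;
  [exact: hs_factor_trans a c | exact: hs_factor_trans d b].
Qed.

Canonical hs_isomb_equiv :=
  EquivRel hs_isomb hs_isomb_refl hs_isomb_sym hs_isomb_trans.

Definition hpartition : Type := {eq_quot hs_isomb_equiv}.

HB.instance Definition _ := Choice.on hpartition.

Definition hs_class (q : hsurj) : hpartition := \pi_({eq_quot hs_isomb_equiv}) q.

Lemma hs_classP q q' : hs_class q = hs_class q' <-> hs_isom q q'.
Proof.
rewrite /hs_class; split; first by move=> /eqmodP /asboolP.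
by move=> qq'; apply/eqmodP/asboolP.
Qed.

Lemma hs_class_surj (c : hpartition) : exists q, hs_class q = c.
Proof. by exists (@generic_quotient.repr hsurj {eq_quot hs_isomb_equiv} c); exact: reprK. Qed.

Definition hpartition_le : rel hpartition := fun c' c =>
  `[< exists q' q, [/\ hs_class q' = c', hs_class q = c & hs_factor q' q] >].

Lemma hpartition_leE q' q :
  hpartition_le (hs_class q') (hs_class q) <-> hs_factor q' q.
Proof.
split=> [/asboolP[p' [p [/hs_classP/hs_isom_factor[_ a]
    /hs_classP/hs_isom_factor[b _] p'p]]]|q'q].
  by apply: hs_factor_trans a _; apply: hs_factor_trans p'p b.
by apply/asboolP; exists q', q.
Qed.

Lemma hpartition_le_refl : reflexive hpartition_le.
Proof.
move=> c; have [q <-] := hs_class_surj c.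
by apply/hpartition_leE; exact: hs_factor_refl.
Qed.

Lemma hpartition_le_anti : antisymmetric hpartition_le.
Proof.
move=> c c'; have [q <-] := hs_class_surj c; have [q' <-] := hs_class_surj c'.
by move=> /andP[/hpartition_leE a /hpartition_leE b]; apply/hs_classP/hs_isom_factor.
Qed.

Lemma hpartition_le_trans : transitive hpartition_le.
Proof.
move=> c2 c1 c3; have [q2 <-] := hs_class_surj c2.
have [q1 <-] := hs_class_surj c1; have [q3 <-] := hs_class_surj c3.
move=> /hpartition_leE a /hpartition_leE b.
by apply/hpartition_leE; exact: hs_factor_trans a b.
Qed.

HB.instance Definition _ := Order.Le_isPOrder.Build (Order.Disp tt tt)
  hpartition hpartition_le_refl hpartition_le_anti hpartition_le_trans.

(* For right actions, H/K is the H-set of right cosets K x under right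
   multiplication. *)
Definition copies_of_orbit (n : nat) (K : {set gT}) : Prop :=
  exists f : X -> 'I_n * {C : {set gT} | C \in rcosets K H},
    bijective f /\
    forall x h, h \in H ->
      (f (to x h)).1 = (f x).1 /\ val (f (to x h)).2 = (val (f x).2 :* h)%g.

End EquivariantPartitions.

(* Main.v *)
Require Import Defs.
From Stdlib Require Import Relation_Operators.
From mathcomp Require Import all_boot all_order all_algebra all_fingroup.
From mathcomp Require Import all_classical all_reals topology normedtype.

(** A point of the realization of a finite poset is the same thing as a system
    of barycentric coordinates: nonnegative weights of sum 1 on the elements
    whose support is a chain. The realization carries the initial topology of
    these coordinates ([coords_surj], [coords_inj], [coords_initial]), so maps
    into it and homotopies between them can be written down on weights.

    First claim. A group element moves a partition to a comparable one only if
    it fixes it, because translates have equally many pairs of elements in a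
    common block. Hence a fixed point of the realization is supported on
    invariant partitions ([fixed_realizationP]). Invariant partitions are the
    same, with the same order, as isomorphism classes of equivariant surjections
    ([hpartition_embedding]). The two spaces therefore have the same coordinates
    and are even homeomorphic.

    Second claim. Let s be the partition of A into H-orbits. If an invariant
    partition y were a complement of s, every orbit would meet the blocks of y
    in single points and H would permute the blocks transitively; all orbits
    would then be isomorphic to A/y, and A would be a disjoint union of copies
    of H/K ([copies_of_orbit_of_map]). If A is not of this form, s is a proper
    partition, and each invariant proper partition has an invariant proper upper
    or lower bound in common with s ([orbit_partition_no_complement]).

    It remains to contract a bounded lattice, without its bounds, in which an
    element s has no complement ([noncomplemented_null_homotopic]). Let V be the
    set of the x with x v s below the top. If V is everything, then
    x <= x v s >= s is a contraction by monotone maps. In general V has to be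
    reached first. Take a chain with largest element t, and let x be the largest
    of its elements in V. Send the chain to t if t lies in V, to the meet of
    x v s and t if t does not lie in V but x exists, and to the meet of s and t
    otherwise. This is a monotone map from the poset of chains to V which lies
    below the map sending a chain to its largest element. The latter induces the
    identity up to homotopy after barycentric subdivision ([push_homotopic_id]),
    and ordered monotone maps are homotopic ([push_homotopic_le]). *)

Set Implicit Arguments.
Unset Strict Implicit.
Unset Printing Implicit Defensive.

Import Order.TTheory GRing.Theory Num.Theory.
Import numFieldNormedType.Exports.

Local Open Scope classical_set_scope.
Local Open Scope ring_scope.

(** * Continuity *)

Lemma continuous_sum (R : realType) (X : topologicalType) (I : Type)
    (r : seq I) (P : pred I) (F : I -> X -> R) :
  (forall i, P i -> continuous (F i)) ->
  continuous (fun x => \sum_(i <- r | P i) F i x).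
Proof.
by move=> cF; apply: continuous_big => //; exact: add_continuous.
Qed.

Lemma continuous_prod (R : realType) (X : topologicalType) (I : Type)
    (r : seq I) (P : pred I) (F : I -> X -> R) :
  (forall i, P i -> continuous (F i)) ->
  continuous (fun x => \prod_(i <- r | P i) F i x).
Proof. by move=> cF; apply: continuous_big => //; exact: mul_continuous. Qed.

Lemma continuous_row (R : realType) (X : topologicalType) (n : nat)
    (f : X -> 'rV[R]_n) :
  (forall i, continuous (fun x => f x ord0 i)) -> continuous f.
Proof.
move=> cf x U [V nV sVU]; apply: filterS sVU _.
suff: \forall y \near x, forall k, V ord0 k (f y ord0 k).
  by apply: filterS => y + i j; rewrite (ord1 i).
apply: filter_forall => k; exact: (cf k x (V ord0 k) (nV ord0 k)).
Qed.

(** The pasting lemma for a finite closed cover, the pieces of e being given as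
    restrictions of globally continuous maps g i. *)
Lemma continuous_closed_pieces (X Y : topologicalType) (I : finType)
    (good : I -> Prop) (K : I -> set X) (e : X -> Y) (g : I -> X -> Y) :
  (forall i, closed (K i)) ->
  (forall x, exists2 i, good i & K i x) ->
  (forall i, good i -> continuous (g i)) ->
  (forall i x, good i -> K i x -> g i x = e x) ->
  continuous e.
Proof.
move=> cK cov cg ge; apply/continuous_closedP => C cC.
have -> : e @^-1` C = \bigcup_(i in [set i | good i]) (K i `&` g i @^-1` C).
  apply/seteqP; split=> [x /= Cx|x [i /= gi [Kx]]].
    by have [i gi Kx] := cov x; exists i => //; split=> //=; rewrite (ge i).
  by rewrite /= (ge i).
apply: closed_bigcup; first exact: finite_finset.
by move=> i gi; apply: closedI => //; move/continuous_closedP: (cg i gi); apply.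
Qed.

(** * Barycentric coordinates on the realization of a poset *)

Section Weights.
Variables (R : realType) (d : Order.disp_t) (P : finPOrderType d).

(** A point of the order complex of the subposet S, in barycentric
    coordinates. *)
Definition weight (S : {set P}) (w : P -> R) : Prop :=
  [/\ forall p, 0 <= w p, \sum_p w p = 1,
      forall p, w p != 0 -> p \in S &
      forall p q, w p != 0 -> w q != 0 -> (p >=< q)%O].

Definition supp (w : P -> R) : {set P} := finset (fun p => w p != 0).

Lemma weight_supp_neq0 S w : weight S w -> supp w != finset.set0.
Proof.
move=> [_ w1 _ _]; apply/eqP => s0; move/eqP: w1.
rewrite big1 => [|p _]; first by rewrite eq_sym oner_eq0.
have : p \notin supp w by rewrite s0 inE.
by rewrite inE negbK => /eqP.
Qed.
Definition chain (S D : {set P}) : bool :=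
  [&& D != finset.set0, D \subset S &
      [forall p in D, forall q in D, (p >=< q)%O]].

Lemma chainP (S D : {set P}) : 
  reflect [/\ D != finset.set0, forall p, p \in D -> p \in S &
            forall p q, p \in D -> q \in D -> (p >=< q)%O] (chain S D).
Proof.
apply: (iffP and3P) => -[D0 DS Dc]; split=> //.
- exact/fintype.subsetP.
- by move=> p q pD qD; move/forall_inP/(_ p pD)/forall_inP/(_ q qD): Dc.
- exact/fintype.subsetP.
- by apply/forall_inP => p pD; apply/forall_inP => q qD; apply: Dc.
Qed.

Lemma supp_chain S w : weight S w -> chain S (supp w).
Proof.
move=> Sw; have [_ _ wS wc] := Sw; apply/chainP; split.
- exact: weight_supp_neq0 Sw.
- by move=> p; rewrite inE; exact: wS.
- by move=> p q; rewrite !inE; exact: wc.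
Qed.

End Weights.

(** The poset Q need not be a finite type; it is viewed inside the finite
    poset P through an order embedding j, and a point of its realization is
    described by its barycentric coordinates on P. *)
Section Coordinates.
Variables (R : realType) (d d' : Order.disp_t).
Variables (Q : porderType d') (P : finPOrderType d) (j : Q -> P).
Hypothesis j_emb : forall x y, (j x <= j y)%O = (x <= y)%O.

Lemma emb_inj : injective j.
Proof. by move=> x y e; apply/le_anti; rewrite -!j_emb e lexx. Qed.

Definition cell_coords (x : cells R Q) (p : P) : R :=
  \sum_(i | j (val (tagged (tag x)) i) == p) val (tagged x) ord0 i.

Lemma cell_coords_glue x y :
  clos_refl_sym_trans _ Defs.glue x y -> cell_coords x = cell_coords y.
Proof.
elim=> [{}x {}y|//|{}x {}y _ ->//|{}x {}y z _ -> _ ->//].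
case=> m n th th_mono c t; apply/funext => p; rewrite /cell_coords /=.
under eq_bigl do rewrite ffunE.
under [RHS]eq_bigr do rewrite mxE.
rewrite (partition_big th (fun k => j (val c k) == p)) //=.
apply: eq_bigr => k /eqP kp; apply: eq_bigl => i.
by case: (th i =P k) => [->|]; rewrite ?andbF // kp eqxx.
Qed.

Definition coords (x : realization R Q) : P -> R :=
  cell_coords (of_realization x).

Lemma coordsE x : coords (to_realization x) = cell_coords x.
Proof.
by apply: cell_coords_glue; apply/to_realizationP; rewrite of_realizationK.
Qed.

Lemma cell_coords_neq0 n (c : nerve Q n) (t : simplex R n) p :
  cell_coords (cell c t) p != 0 -> exists i, j (val c i) = p.
Proof.
move=> h; have [[i /eqP ip]|no] := pselect (exists i, j (val c i) == p).
  by exists i.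
move: h; rewrite /cell_coords big1 ?eqxx // => i ip; exfalso.
by apply: no; exists i.
Qed.

Lemma coords_continuous p : continuous (coords^~ p).
Proof.
apply/quotient_continuous.
rewrite (_ : _ \o _ = cell_coords^~ p); last first.
  by apply/funext => x /=; rewrite -[RHS](congr1 (@^~ p) (coordsE x)).
suff cs (s : {n : nat & nerve Q n}) : continuous
    (fun t : simplex R (tag s) =>
      \sum_(i | j (val (tagged s) i) == p) val t ord0 i).
  by move=> [s t] U nU; exact: (cs s t U nU).
apply: continuous_sum => i _.
move=> t; apply: (@continuous_comp (simplex R (tag s)) 'rV[R]_(tag s).+1 R
  set_val (fun r => r ord0 i)); first exact: initial_continuous.
exact: coord_continuous.
Qed.

Section Image.
Variable S : {set P}.
Hypothesis S_image : forall p, p \in S <-> exists x, j x = p.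

Lemma coords_weight x : weight S (coords x).
Proof.
rewrite -(of_realizationK x) coordsE; case: (of_realization x) => -[n c] t.
split.
- move=> p; apply: sumr_ge0 => i _; have /set_mem[t0 _] := valP t; exact: t0.
- have /set_mem[_ <-] := valP t.
  by rewrite [RHS](partition_big (fun i => j (val c i)) predT).
- by move=> p /(@cell_coords_neq0 _ c t)[i ip]; apply/S_image; exists (val c i).
- move=> p q /(@cell_coords_neq0 _ c t)[i <-] /(@cell_coords_neq0 _ c t)[k <-].
  case/orP: (leq_total i k) => ik; rewrite /Order.comparable !j_emb.
    by rewrite nerve_mono.
  by rewrite (nerve_mono c ik) orbT.
Qed.

(** The nerve element c is the nondegenerate simplex with vertex set D. *)
Definition enumerates (D : {set P}) n (c : nerve Q n) : Prop :=
  injective (val c) /\ (forall p, p \in D <-> exists i, j (val c i) = p).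

Lemma chain_enum (D : {set P}) :
  chain S D -> exists n (c : nerve Q n), enumerates D c.
Proof.
move=> /chainP[D0 DS Dc].
have [x0 _] : exists x0 : Q, True.
  by have /set0Pn[p /DS /S_image[x _]] := D0; exists x.
have /choice[k kP] : forall p, exists x, p \in D -> j x = p.
  move=> p; case: (boolP (p \in D)) => [/DS /S_image[x <-]|]; first by exists x.
  by exists x0.
pose s := sort <=%O (enum D).
have sE p : (p \in s) = (p \in D) by rewrite mem_sort mem_enum.
have s_uniq : uniq s by rewrite sort_uniq enum_uniq.
have s_size : size s = #|D|.-1.+1.
  by rewrite size_sort -cardE prednK // card_gt0.
have s_sorted : sorted <=%O s.
  apply: (@sort_sorted_in _ (mem D)) => [p q pD qD|].
    exact: Dc.
  by apply/allP => p; rewrite mem_enum.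
have sP i : (i < #|D|.-1.+1)%N -> nth (j x0) s i \in D.
  by rewrite -s_size -sE => ?; exact: mem_nth.
pose f := [ffun i : 'I_#|D|.-1.+1 => k (nth (j x0) s i)].
have jf i : j (f i) = nth (j x0) s i by rewrite ffunE kP // sP.
have f_mono : [forall i : 'I_#|D|.-1.+1, forall l : 'I_#|D|.-1.+1,
    (i <= l)%N ==> (f i <= f l)%O].
  apply/'forall_'forall_implyP => i l il; rewrite -j_emb !jf.
  apply: (sorted_leq_nth le_trans) => //.
  - by rewrite inE s_size.
  - by rewrite inE s_size.
exists #|D|.-1, (exist _ f f_mono); split=> /= [i l|p].
  move/(congr1 j); rewrite !jf => /eqP; rewrite nth_uniq ?s_size //.
  by move=> /eqP/val_inj.
split=> [|[i <-]]; last by rewrite jf sP.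
rewrite -sE => /(nthP (j x0))[i]; rewrite s_size => il ip.
by exists (Ordinal il); rewrite jf.
Qed.

Lemma cell_coords_enum (D : {set P}) n (c : nerve Q n) (t : simplex R n) k :
  enumerates D c -> cell_coords (cell c t) (j (val c k)) = val t ord0 k.
Proof.
move=> [c_inj _]; rewrite /cell_coords /= (big_pred1 k) // => i.
by apply/eqP/eqP => [/emb_inj/c_inj|->].
Qed.

(** A simplex with vertices in D factors through the nondegenerate simplex on
    D by a monotone map of indices, so its points are glued to points of that
    simplex. *)
Lemma glue_into_enum (D : {set P}) n (c : nerve Q n) m (c' : nerve Q m)
    (t : simplex R m) :
  enumerates D c -> (forall i, j (val c' i) \in D) ->
  exists u, to_realization (cell c' t) = to_realization (cell c u).
Proof.
move=> [c_inj cD] c'D.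
have /choice[th thP] : forall i, exists k, val c k = val c' i.
  by move=> i; have /cD[k /emb_inj kp] := c'D i; exists k.
have th_mono : {homo th : i l / (i <= l)%N}.
  move=> i l il; rewrite leqNgt; apply/negP => li.
  have le1 : (val c (th i) <= val c (th l))%O by rewrite !thP nerve_mono.
  have le2 := nerve_mono c (ltnW li).
  have /c_inj e : val c (th i) = val c (th l) by apply/le_anti; rewrite le1 le2.
  by rewrite e ltnn in li.
have -> : c' = nerve_pull th_mono c.
  by apply: val_inj; apply/ffunP => i; rewrite /= ffunE thP.
exists (simplex_push th t); apply/to_realizationP.
by apply: rst_step; exact: Glue.
Qed.

(** Both the simplex carrying x and the simplex c, whose vertices all have
    positive mass in x, map into the nondegenerate simplex on the vertices of
    the former, and a point of a nondegenerate simplex is determined by its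
    coordinates. *)
Lemma cell_of_coords n (c : nerve Q n) (u : simplex R n)
    (x : realization R Q) :
  (forall i, coords x (j (val c i)) != 0) -> cell_coords (cell c u) = coords x ->
  to_realization (cell c u) = x.
Proof.
rewrite -(of_realizationK x); case: (of_realization x) => -[m c'] t.
rewrite coordsE => cx uE.
pose D : {set P} := finset (fun p => [exists i, j (val c' i) == p]).
have DP p : p \in D <-> exists i, j (val c' i) = p.
  rewrite inE; split=> [/existsP[i /eqP <-]|[i <-]]; first by exists i.
  by apply/existsP; exists i.
have chD : chain S D.
  apply/chainP; split.
  - by apply/set0Pn; exists (j (val c' ord0)); apply/DP; exists ord0.
  - by move=> p /DP[i <-]; apply/S_image; exists (val c' i).
  - move=> p q /DP[i <-] /DP[k <-]; rewrite /Order.comparable !j_emb.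
    case/orP: (leq_total i k) => ik; first by rewrite nerve_mono.
    by rewrite (nerve_mono c' ik) orbT.
have [l [e eD]] := chain_enum chD.
have [|v vE] := @glue_into_enum _ _ e _ c u eD.
  by move=> i; have /(@cell_coords_neq0 _ c' t)[k kE] := cx i; apply/DP; exists k.
have [|v' vE'] := @glue_into_enum _ _ e _ c' t eD.
  by move=> i; apply/DP; exists i.
rewrite vE vE'; congr (to_realization (cell e _)).
apply: val_inj; apply/rowP => k.
rewrite -!(cell_coords_enum _ _ eD) -!coordsE -vE -vE' !coordsE.
by rewrite uE.
Qed.

Lemma cell_coords_weight (D : {set P}) n (c : nerve Q n) (u : simplex R n) w :
  enumerates D c -> (forall p, w p != 0 -> p \in D) ->
  (forall k, val u ord0 k = w (j (val c k))) -> cell_coords (cell c u) = w.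
Proof.
move=> cD wD uE; apply/funext => p; case: (boolP (p \in D)) => [pD|pD].
  by have /cD.2[k <-] := pD; rewrite (cell_coords_enum _ _ cD) uE.
apply/eqP; rewrite (_ : w p = 0); last first.
  by apply/eqP; apply: contraR pD; exact: wD.
apply/eqP; apply: contraNeq pD => /(@cell_coords_neq0 _ c u)[k <-].
by apply/cD.2; exists k.
Qed.

Lemma sum_enum (D : {set P}) n (c : nerve Q n) (w : P -> R) :
  weight S w -> enumerates D c -> (forall p, w p != 0 -> p \in D) ->
  \sum_k w (j (val c k)) = 1.
Proof.
move=> [_ <- _ _] [c_inj cD] wD.
rewrite [RHS](bigID (mem D)) /= [X in _ + X]big1 ?addr0; last first.
  by move=> p pD; apply/eqP; apply: contraR pD; exact: wD.
rewrite -(big_imset w (h := fun k => j (val c k)) (A := predT)) /=.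
  apply: eq_bigl => p; apply/imsetP/idP => [[k _ ->]|/cD[k <-]].
    by apply/cD; exists k.
  by exists k.
by move=> k l _ _ /emb_inj/c_inj.
Qed.

Lemma coords_surj (w : P -> R) : weight S w -> exists x, coords x = w.
Proof.
move=> Sw; have [n [c cD]] := chain_enum (supp_chain Sw).
have wD p : w p != 0 -> p \in supp w by rewrite inE.
have [w0 _ _ _] := Sw.
have u_simplex : \row_k w (j (val c k)) \in simplex R n.
  apply/mem_set; split=> [k|]; first by rewrite mxE.
  by under eq_bigr do rewrite mxE; exact: sum_enum Sw cD wD.
exists (to_realization (cell c (exist (fun v => v \in simplex R n) _ u_simplex))).
by rewrite coordsE; apply: cell_coords_weight cD wD _ => k; rewrite /= mxE.
Qed.

(** Every point is the one with its own coordinates in the nondegenerate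
    simplex on its support. *)
Lemma coords_inj : injective coords.
Proof.
suff canon x n (c : nerve Q n) : enumerates (supp (coords x)) c ->
    exists2 u : simplex R n, (forall k, val u ord0 k = coords x (j (val c k))) &
      to_realization (cell c u) = x.
  move=> x y xy; have [n [c cx]] := chain_enum (supp_chain (coords_weight x)).
  have cy : enumerates (supp (coords y)) c by rewrite -xy.
  have [u uE <-] := canon _ _ _ cx; have [v vE <-] := canon _ _ _ cy.
  congr (to_realization (cell c _)).
  by apply: val_inj; apply/rowP => k; rewrite uE vE xy.
move=> cx; have xD p : coords x p != 0 -> p \in supp (coords x) by rewrite inE.
have Sx := coords_weight x; have [w0 _ _ _] := Sx.
have u_simplex : \row_k coords x (j (val c k)) \in simplex R n.
  apply/mem_set; split=> [k|]; first by rewrite mxE.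
  by under eq_bigr do rewrite mxE; exact: sum_enum Sx cx xD.
exists (exist (fun v => v \in simplex R n) _ u_simplex) => [k|]; first by rewrite /= mxE.
apply: cell_of_coords.
  move=> k; have : j (val c k) \in supp (coords x) by apply/cx.2; exists k.
  by rewrite inE.
by apply: cell_coords_weight cx xD _ => k; rewrite /= mxE.
Qed.

(** The quotient topology is the initial topology of the coordinates: P being
    finite, the sets of points supported in a given chain D form a finite
    closed cover, and on each of them the point is recovered continuously from
    its coordinates inside the nondegenerate simplex on D. *)
Lemma coords_initial (X : topologicalType) (e : X -> realization R Q) :
  (forall p, continuous (fun x => coords (e x) p)) -> continuous e.
Proof.
move=> ce; pose F x p := coords (e x) p.
pose K (D : {set P}) : set X := [set x | forall p, p \notin D -> F x p = 0].
pose good (D : {set P}) := chain S D /\ exists x, K D x.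
have Dg D : exists g : X -> realization R Q, good D ->
    continuous g /\ forall x, K D x -> g x = e x.
  have [[chD [x0 Kx0]]|] := pselect (good D); last by exists e.
  have [n [c cD]] := chain_enum chD.
  (* Outside of K D the coordinates on D sum to less than 1; giving the missing
     mass to the vertex 0 yields a point of the simplex for every x. *)
  pose row_of x : 'rV[R]_n.+1 := \row_k (F x (j (val c k)) +
    (k == ord0)%:R * (1 - \sum_l F x (j (val c l)))).
  have row_simplex x : row_of x \in simplex R n.
    have [w0 w1 _ _] := coords_weight (e x); apply/mem_set; split=> [k|].
      rewrite mxE addr_ge0 ?mulr_ge0 ?w0 ?ler0n // subr_ge0 -w1.
      rewrite -(big_imset (F x) (h := fun k => j (val c k)) (A := predT)) /=.
        rewrite [leRHS](bigID (mem [set j (val c k) | k in predT]%SET)) /=.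
        by rewrite lerDl sumr_ge0.
      by move=> k' l _ _ /emb_inj/cD.1.
    under eq_bigr do rewrite mxE.
    rewrite big_split /= -mulr_suml (_ : \sum_(i < n.+1) (i == ord0)%:R = 1).
      by rewrite mul1r addrC subrK.
    by rewrite (bigD1 ord0) //= big1 ?addr0 // => i /negbTE ->.
  pose u x : simplex R n :=
    exist (fun v => v \in simplex R n) _ (row_simplex x).
  exists (fun x => to_realization (cell c (u x))); split.
    have cu : continuous u.
      apply: (@continuous_comp_initial _ _ _ (@set_val _ (simplex R n))).
      apply: continuous_row => k.
      rewrite (_ : (fun _ => _) = fun x => F x (j (val c k)) +
          (k == ord0)%:R * (1 - \sum_l F x (j (val c l)))); last first.
        by apply/funext => x; rewrite /= set_valE mxE.
      move=> x; apply: cvgD; first exact: ce.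
      apply: cvgM; first exact: cvg_cst.
      apply: cvgB; first exact: cvg_cst.
      apply: (continuous_sum (F := fun l x => F x (j (val c l)))) => l _.
      exact: ce.
    move=> x; apply: (@continuous_comp _ (cells R Q) _
      (fun x => cell c (u x)) (@to_realization R d' Q)).
      apply: (@continuous_comp X (simplex R n) (cells R Q) u (@cell R _ Q n c)).
        exact: cu.
      by move=> U nU; exact: nU.
    exact: pi_continuous.
  move=> x Kx; apply: coords_inj; rewrite coordsE.
  have Fx p : F x p != 0 -> p \in D by apply: contraNT => /Kx ->.
  apply: (cell_coords_weight cD Fx) => k.
  by rewrite mxE (sum_enum (coords_weight (e x)) cD Fx) subrr mulr0 addr0.
have /choice[g gP] := Dg.
apply: (@continuous_closed_pieces _ _ _ good K e g).
- move=> D; rewrite (_ : K D =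
      \bigcap_(p in [set p | p \notin D]) [set x | F x p = 0]) //.
    apply: closed_bigI => p _.
    by move/continuous_closedP: (ce p) => /(_ _ (@closed_eq R 0)).
- move=> x; exists (supp (F x)).
    split; first exact: supp_chain (coords_weight _).
    by exists x => p; rewrite inE negbK => /eqP.
  by move=> p; rewrite inE negbK => /eqP.
- by move=> D /gP[].
- by move=> D x /gP[_ ]; apply.
Qed.

End Image.
End Coordinates.

(** * Homotopies between families of weights *)

Section Clamp.
Variable R : realType.

(** Homotopies are parametrised by the whole line; times outside of the unit
    interval are clamped to it, which keeps every map globally continuous. *)
Definition clamp (t : R) : R := Num.max 0 (Num.min 1 t).

Lemma clamp_ge0 t : 0 <= clamp t.
Proof. by rewrite le_max lexx. Qed.

Lemma clamp_le1 t : clamp t <= 1.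
Proof. by rewrite ge_max ler01 ge_min lexx. Qed.

Lemma clamp_le0E t : t <= 0 -> clamp t = 0.
Proof.
by move=> t0; rewrite /clamp (min_idPr _) ?(le_trans t0) // (max_idPl _).
Qed.

Lemma clamp_ge1E t : 1 <= t -> clamp t = 1.
Proof. by move=> t1; rewrite /clamp (min_idPl _) // (max_idPr _). Qed.

Lemma clamp_continuous : continuous clamp.
Proof.
move=> t; apply: continuous_max; first exact: cvg_cst.
by apply: continuous_min; [exact: cvg_cst|exact: cvg_id].
Qed.
End Clamp.

Section WeightHomotopy.
Variables (R : realType) (d : Order.disp_t) (P : finPOrderType d).
Variables (S : {set P}) (X : topologicalType).

Definition weight_map (T : topologicalType) (f : T -> P -> R) : Prop :=
  (forall p, continuous (f^~ p)) /\ (forall x, weight S (f x)).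

Definition weight_homotopic (f g : X -> P -> R) : Prop :=
  exists F : X * R -> P -> R,
    [/\ weight_map F, forall x, F (x, 0) = f x & forall x, F (x, 1) = g x].

Lemma continuous_comp_pair (F : X * R -> P -> R) (s : R -> R) p :
  (forall p, continuous (F^~ p)) -> continuous s ->
  continuous (fun z : X * R => F (z.1, s z.2) p).
Proof.
move=> cF cs z.
apply: (@continuous_comp (X * R)%type (X * R)%type R
  (fun z => (z.1, s z.2)) (F^~ p)); last exact: cF.
apply: (@cvg_pair _ _ _ (nbhs z) (nbhs z.1) (nbhs (s z.2))).
  exact: cvg_fst.
by apply: (@cvg_comp _ _ _ snd s); [exact: cvg_snd|exact: cs].
Qed.

Lemma weight_homotopic_sym f g : weight_homotopic f g -> weight_homotopic g f.
Proof.
move=> [F [[cF wF] F0 F1]]; exists (fun z => F (z.1, 1 - z.2)); split.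
- split=> // p; apply: (continuous_comp_pair (s := fun t => 1 - t)) => // t.
  by apply: cvgB; [exact: cvg_cst|exact: cvg_id].
- by move=> x /=; rewrite subr0 F1.
- by move=> x /=; rewrite subrr F0.
Qed.

(** The concatenation is the sum of the two halves minus their common middle
    map, since at each time one of the two is standing still; this form needs
    no pasting. *)
Lemma weight_homotopic_trans g f h :
  weight_homotopic f g -> weight_homotopic g h -> weight_homotopic f h.
Proof.
move=> [F [[cF wF] F0 F1]] [G [[cG wG] G0 G1]].
pose K (z : X * R) p :=
  F (z.1, clamp (2 * z.2)) p + (G (z.1, clamp (2 * z.2 - 1)) p - F (z.1, 1) p).
have KE z : K z = if z.2 <= 2^-1 then F (z.1, clamp (2 * z.2))
                  else G (z.1, clamp (2 * z.2 - 1)).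
  apply/funext => p; rewrite /K F1 -G0; case: leP => t.
    rewrite (@clamp_le0E _ (_ - 1)) ?subrr ?addr0 //.
    by rewrite subr_le0 -ler_pdivlMl // mulr1.
  rewrite (@clamp_ge1E _ (2 * _)); first by rewrite F1 G0 addrC subrK.
  by rewrite -ler_pdivrMl // mulr1 ltW.
exists K; split.
- split=> [p|z]; last by rewrite KE; case: ifP.
  have c2 : continuous (fun t : R => 2 * t).
    by move=> t; apply: cvgM; [exact: cvg_cst|exact: cvg_id].
  move=> z; apply: cvgD.
    apply: (continuous_comp_pair (s := fun t => clamp (2 * t))) => // t.
    apply: (@cvg_comp _ _ _ (fun t => 2 * t) (@clamp R)); first exact: c2.
    exact: clamp_continuous.
  apply: cvgB.
    apply: (continuous_comp_pair (s := fun t => clamp (2 * t - 1))) => // t.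
    apply: (@cvg_comp _ _ _ (fun t => 2 * t - 1) (@clamp R)).
      by apply: cvgB; [exact: c2|exact: cvg_cst].
    exact: clamp_continuous.
  by apply: (continuous_comp_pair (s := fun=> 1)) => // t; exact: cvg_cst.
- by move=> x; rewrite KE /= invr_ge0 ler0n mulr0 clamp_le0E.
- move=> x; rewrite KE /= ifF; last first.
    by apply/negbTE; rewrite -ltNge invf_lt1 ?ltr1n.
  by rewrite mulr1 clamp_ge1E ?G1 // lerBrDr.
Qed.

(** The segment from f x to g x stays in the order complex because the union of
    the two supports is a chain. *)
Lemma weight_homotopic_line f g :
  weight_map f -> weight_map g ->
  (forall x p q, f x p != 0 -> g x q != 0 -> (p >=< q)%O) ->
  weight_homotopic f g.
Proof.
move=> [cf wf] [cg wg] fg.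
exists (fun z p => (1 - clamp z.2) * f z.1 p + clamp z.2 * g z.1 p); split.
- split=> [p z|[x t]].
    have cc : (fun z : X * R => clamp z.2) @ z --> clamp z.2.
      apply: (@cvg_comp _ _ _ snd (@clamp R)); first exact: cvg_snd.
      exact: clamp_continuous.
    apply: cvgD; apply: cvgM => //.
    + by apply: cvgB => //; exact: cvg_cst.
    + by apply: (@cvg_comp _ _ _ fst (f^~ p)); [exact: cvg_fst|exact: cf].
    + by apply: (@cvg_comp _ _ _ fst (g^~ p)); [exact: cvg_fst|exact: cg].
  have [f0 f1 fS fc] := wf x; have [g0 g1 gS gc] := wg x.
  have or0 p : (1 - clamp t) * f x p + clamp t * g x p != 0 ->
      f x p != 0 \/ g x p != 0.
    have [->|] := eqVneq (f x p) 0; last by left.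
    have [->|] := eqVneq (g x p) 0; last by right.
    by rewrite !mulr0 addr0 eqxx.
  split=> /=.
  + by move=> p; rewrite addr_ge0 // mulr_ge0 ?clamp_ge0 // subr_ge0 clamp_le1.
  + by rewrite big_split /= -!mulr_sumr f1 g1 !mulr1 subrK.
  + by move=> p /or0[/fS|/gS].
  + move=> p q /or0[hp|hp] /or0[hq|hq]; [exact: fc|exact: fg hp hq| |exact: gc].
    by rewrite comparable_sym; exact: fg hq hp.
- by move=> x; apply/funext => p; rewrite clamp_le0E // subr0 mul1r mul0r addr0.
- by move=> x; apply/funext => p; rewrite clamp_ge1E // subrr mul1r mul0r add0r.
Qed.
End WeightHomotopy.

(** * Barycentric subdivision *)

Section Subdivision.
Variables (R : realType) (d : Order.disp_t) (P : finPOrderType d).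
Variable (S : {set P}).

(** The mass is positive exactly for the nonempty superlevel sets c of w inside
    its support. These form a flag of chains, so normalising the masses maps w
    to a point of the subdivision. Its position inside the simplex spanned by
    the flag does not matter, only the continuity and the support do. *)
Definition flag_mass (w : P -> R) (c : {set P}) : R :=
  if c == finset.set0 then 0 else
  (\prod_(p in c) w p) *
  \prod_(p in c) \prod_(q | q \notin c) Num.max 0 (w p - w q).

Definition flag_weight (w : P -> R) (c : {set P}) : R :=
  flag_mass w c / \sum_c' flag_mass w c'.

Lemma flag_mass_ge0 w c : weight S w -> 0 <= flag_mass w c.
Proof.
move=> [w0 _ _ _]; rewrite /flag_mass; case: ifP => // _; apply: mulr_ge0.
  exact: prodr_ge0.
by apply: prodr_ge0 => p _; apply: prodr_ge0 => q _; rewrite le_max lexx.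
Qed.

Lemma flag_mass_neq0 w c :
  flag_mass w c != 0 <->
  [/\ c != finset.set0, c \subset supp w &
      forall p q, p \in c -> q \notin c -> w q < w p].
Proof.
rewrite /flag_mass; case: (eqVneq c finset.set0) => [_|c0].
  by split=> [|[]]; rewrite ?eqxx.
rewrite mulf_eq0 negb_or; split.
  move=> /andP[/prodf_neq0 wc /prodf_neq0 wq]; split=> //.
    by apply/fintype.subsetP => p pc; rewrite inE wc.
  move=> p q pc qc; have /prodf_neq0/(_ q qc) := wq p pc.
  by rewrite ltNge; apply: contra => pq; rewrite (max_idPl _) // subr_le0.
move=> [_ /fintype.subsetP cw wq]; apply/andP; split.
  by apply/prodf_neq0 => p /cw; rewrite inE.
apply/prodf_neq0 => p pc; apply/prodf_neq0 => q qc.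
by rewrite (max_idPr _) ?subr_ge0 ?subr_eq0 ?gt_eqF ?ltW ?wq.
Qed.

Lemma flag_mass_nested w c c' : flag_mass w c != 0 -> flag_mass w c' != 0 ->
  c \subset c' \/ c' \subset c.
Proof.
move=> /flag_mass_neq0[_ _ wc] /flag_mass_neq0[_ _ wc'].
case: (boolP (c \subset c')) => [|/subsetPn[p pc pc']]; first by left.
right; apply/fintype.subsetP => q qc'; apply: contraT => qc.
by have := lt_trans (wc p q pc qc) (wc' q p qc' pc'); rewrite ltxx.
Qed.

Lemma flag_mass_gt0 w : weight S w -> 0 < \sum_c flag_mass w c.
Proof.
move=> Sw; have [w0 _ _ _] := Sw.
have /set0Pn[p0 _] := weight_supp_neq0 Sw.
pose m := [arg max_(p > p0) w p]%O; pose c : {set P} := finset (fun p => w p == w m).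
have wm p : w p <= w m by rewrite /m; case: arg_maxP => // i _ /(_ p isT).
have mc : flag_mass w c != 0.
  apply/flag_mass_neq0; split.
  - by apply/set0Pn; exists m; rewrite inE.
  - apply/fintype.subsetP => p; rewrite !inE => /eqP ->.
    have /set0Pn[p1] := weight_supp_neq0 Sw; rewrite inE => p10.
    by rewrite gt_eqF // (lt_le_trans _ (wm p1)) // lt_def p10 w0.
  - by move=> p q; rewrite !inE => /eqP -> qm; rewrite lt_def eq_sym qm wm.
rewrite lt_def sumr_ge0 ?andbT; last by move=> c' _; exact: flag_mass_ge0.
rewrite psumr_eq0 => [|c' _]; last exact: flag_mass_ge0.
by apply/negP => /allP/(_ c); rewrite mem_index_enum (negbTE mc) => /(_ isT).
Qed.

Lemma flag_mass_chain w c : weight S w -> flag_mass w c != 0 ->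
  chain S c /\ c \subset supp w.
Proof.
move=> Sw /flag_mass_neq0[c0 /fintype.subsetP cw _].
have [_ _ wS wc] := Sw; split; last exact/fintype.subsetP.
apply/chainP; split=> //.
  by move=> p /cw; rewrite inE; exact: wS.
by move=> p q /cw + /cw; rewrite !inE; exact: wc.
Qed.

Lemma flag_weight_neq0 w c : flag_weight w c != 0 -> flag_mass w c != 0.
Proof. by apply: contraNN => /eqP c0; rewrite /flag_weight c0 mul0r. Qed.

Lemma flag_weight_ge0 w c : weight S w -> 0 <= flag_weight w c.
Proof.
by move=> Sw; apply: divr_ge0; [exact: flag_mass_ge0|exact/ltW/flag_mass_gt0].
Qed.

Lemma sum_flag_weight w : weight S w -> \sum_c flag_weight w c = 1.
Proof. by move=> Sw; rewrite -mulr_suml divff // gt_eqF ?flag_mass_gt0. Qed.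

Lemma flag_weight_continuous (X : topologicalType) (f : X -> P -> R) c :
  weight_map S f -> continuous (fun x => flag_weight (f x) c).
Proof.
move=> [cf wf].
have cm c' : continuous (fun x => flag_mass (f x) c').
  rewrite /flag_mass; case: (c' == finset.set0); first exact: cst_continuous.
  move=> x; apply: cvgM; first exact: (@continuous_prod _ _ _ _ _ (fun p x => f x p)).
  apply: (@continuous_prod _ _ _ _ _ (fun p x =>
    \prod_(q | q \notin c') Num.max 0 (f x p - f x q))) => p _.
  apply: continuous_prod => q _ y.
  apply: (@continuous_max R X (fun=> 0) (fun x => f x p - f x q)).
    exact: cvg_cst.
  by apply: cvgB; exact: cf.
move=> x; apply: cvgM; first exact: cm.
apply: cvgV; first by rewrite gt_eqF ?flag_mass_gt0.
exact: (@continuous_sum _ _ _ _ _ (fun c' x => flag_mass (f x) c')).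
Qed.

Section Push.
Variables (X : topologicalType) (f : X -> P -> R).
Hypothesis wf : weight_map S f.

(** The map induced on realizations by a map h from the subdivision to P,
    composed with f. *)
Definition push (h : {set P} -> P) (x : X) (p : P) : R :=
  \sum_(c | h c == p) flag_weight (f x) c.

Definition chain_map (h : {set P} -> P) : Prop :=
  (forall c, chain S c -> h c \in S) /\
  (forall c c', chain S c -> chain S c' -> c \subset c' -> (h c <= h c')%O).

Lemma push_neq0 h x p : push h x p != 0 ->
  exists c, [/\ chain S c, c \subset supp (f x), flag_mass (f x) c != 0 & h c = p].
Proof.
move=> hp; have [[c /andP[/eqP cp c0]]|no] :=
  pselect (exists c, (h c == p) && (flag_mass (f x) c != 0)).
  by have [] := flag_mass_chain (wf.2 x) c0; exists c.
move: hp; rewrite /push big1 ?eqxx // => c cp.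
apply/eqP; apply: contrapT => /negP/flag_weight_neq0 c0.
by apply: no; exists c; rewrite cp.
Qed.

Lemma push_weight_map h : chain_map h -> weight_map S (push h).
Proof.
move=> [hS h_mono]; split=> [p|x].
  by apply: continuous_sum => c _; exact: flag_weight_continuous.
have Sx := wf.2 x; split.
- by move=> p; apply: sumr_ge0 => c _; exact: flag_weight_ge0.
- by rewrite -(sum_flag_weight Sx) [RHS](partition_big h predT).
- by move=> p /push_neq0[c [cc _ _ <-]]; exact: hS.
- move=> p q /push_neq0[c [cc _ c0 <-]] /push_neq0[c' [cc' _ c'0 <-]].
  rewrite /Order.comparable; case: (flag_mass_nested c0 c'0) => le.
    by rewrite h_mono.
  by rewrite (h_mono c' c) ?orbT.
Qed.

Lemma push_homotopic_id h : chain_map h -> (forall c, chain S c -> h c \in c) ->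
  weight_homotopic S f (push h).
Proof.
move=> hm hc; apply: weight_homotopic_line => //; first exact: push_weight_map.
move=> x p q fp /push_neq0[c [cc /fintype.subsetP cx _ <-]].
have := cx _ (hc c cc); rewrite inE => fh.
by have [_ _ _] := wf.2 x; apply.
Qed.

(** Ordered maps induce homotopic ones. The values of h1 and h2 on a flag need
    not form a chain together, but they do if h1 and h2 differ on the chains of
    a single size k only, since a flag has at most one member of size k. Hence
    h2 is turned into h1 one size at a time. *)
Lemma push_homotopic_le h1 h2 : chain_map h1 -> chain_map h2 ->
  (forall c, chain S c -> (h1 c <= h2 c)%O) ->
  weight_homotopic S (push h1) (push h2).
Proof.
move=> [h1S h1m] [h2S h2m] h12.
pose h k (c : {set P}) := if (#|c| < k)%N then h1 c else h2 c.
have h_mono k l c c' : (k <= l.+1)%N -> (l <= k.+1)%N ->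
    chain S c -> chain S c' -> c \subset c' ->
    (h k c <= h l c')%O || ((c == c') && (h k c >=< h l c')%O).
  move=> kl lk cc cc' cc'S; rewrite /h; case: ifP => ck.
    case: ifP => cl; first by rewrite h1m.
    by rewrite (le_trans (h1m _ _ cc cc' cc'S) (h12 _ cc')).
  case: ifP => cl; last by rewrite h2m.
  have /eqP -> : c == c'.
    rewrite eqEcard cc'S /=; move/negbT: ck; rewrite -leqNgt => ck.
    by rewrite -ltnS (leq_trans cl) // (leq_trans lk).
  by rewrite eqxx /Order.comparable h12 ?orbT.
have h_chain k : chain_map (h k).
  split=> [c cc|c c' cc cc' cc'S].
    by rewrite /h; case: ifP => _; [exact: h1S|exact: h2S].
  have /orP[//|/andP[/eqP -> _]] := h_mono k k c c' (leqnSn k) (leqnSn k) cc cc' cc'S.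
  exact: lexx.
have step k : weight_homotopic S (push (h k.+1)) (push (h k)).
  apply: weight_homotopic_line; [exact: push_weight_map|exact: push_weight_map|].
  move=> x p q /push_neq0[c [cc _ c0 <-]] /push_neq0[c' [cc' _ c'0 <-]].
  rewrite /Order.comparable; case: (flag_mass_nested c0 c'0) => cS.
    have /orP[->//|/andP[_]] := h_mono k.+1 k c c' (leqnn _) (leqW (leqnSn k)) cc cc' cS.
    by [].
  have /orP[->|/andP[_]] := h_mono k k.+1 c' c (leqW (leqnSn k)) (leqnn _) cc' cc cS.
    by rewrite orbT.
  by rewrite comparable_sym.
have all k : weight_homotopic S (push (h k)) (push (h 0%N)).
  elim: k => [|k IH]; last exact: weight_homotopic_trans (step k) IH.
  apply: weight_homotopic_line; [exact: push_weight_map|exact: push_weight_map|].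
  move=> x p q hp hq.
  by have [_ _ _] := (push_weight_map (h_chain 0%N)).2 x; apply.
have -> : push h1 = push (h #|P|.+1).
  by congr push; apply/funext => c; rewrite /h ltnS max_card.
exact: all.
Qed.
End Push.
End Subdivision.

(** * Posets with an element without complement *)

(** S plays the part of a finite lattice without its bottom and top: infima
    exist as soon as there is a lower bound. That s has no complement means
    that every y in S has together with s an upper or a lower bound in S. *)
Section Contraction.
Variables (R : realType) (d : Order.disp_t) (P : finPOrderType d).
Variables (S : {set P}) (s : P).
Hypothesis sS : s \in S.
Local Open Scope order_scope.

Definition is_glb (F : {set P}) (g : P) : bool :=
  [&& g \in S, [forall f in F, g <= f] &
      [forall l in S, [forall f in F, l <= f] ==> (l <= g)]].

Hypothesis has_glb : forall (F : {set P}) l f,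
  F \subset S -> f \in F -> l \in S -> (forall f, f \in F -> l <= f) ->
  exists g, is_glb F g.

Hypothesis no_complement : forall y, y \in S ->
  (exists2 u, u \in S & y <= u /\ s <= u) \/
  (exists2 l, l \in S & l <= y /\ l <= s).

Let glb F := odflt s [pick g | is_glb F g].

Let glbP (F : {set P}) l f :
  F \subset S -> f \in F -> l \in S -> (forall f, f \in F -> l <= f) ->
  [/\ glb F \in S, forall f, f \in F -> glb F <= f &
      forall l, l \in S -> (forall f, f \in F -> l <= f) -> l <= glb F].
Proof.
move=> FS fF lS lF; rewrite /glb; case: pickP => [g /= /and3P[gS gF lg]|no].
  split=> //; first exact/forall_inP.
  move=> l' l'S l'F; move/forall_inP/(_ l' l'S)/implyP: lg; apply.
  exact/forall_inP.
by have [g] := has_glb FS fF lS lF; rewrite no.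
Qed.

Let glb2P x y l : x \in S -> y \in S -> l \in S -> l <= x -> l <= y ->
  let g := glb [set x; y]%SET in
  [/\ g \in S, g <= x, g <= y & forall l, l \in S -> l <= x -> l <= y -> l <= g].
Proof.
move=> xS yS lS lx ly g.
have [||||gS gF lg] := @glbP [set x; y]%SET l x.
- by apply/fintype.subsetP => z; rewrite !inE => /orP[] /eqP ->.
- by rewrite !inE eqxx.
- by [].
- by move=> z; rewrite !inE => /orP[] /eqP ->.
split=> //; [by apply: gF; rewrite !inE eqxx|by apply: gF; rewrite !inE eqxx orbT|].
by move=> l' l'S l'x l'y; apply: lg => // z; rewrite !inE => /orP[] /eqP ->.
Qed.

(** The elements whose join with s exists. They form a lower set, which is
    contracted by x <= x v s >= s; each of the others has a meet with s. *)
Let V : {set P} := finset (fun x => [exists u in S, (x <= u) && (s <= u)]).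

Let VP x : reflect (exists2 u, u \in S & x <= u /\ s <= u) (x \in V).
Proof.
rewrite inE; apply: (iffP exists_inP) => -[u uS]; first by move=> /andP; exists u.
by move=> [xu su]; exists u; rewrite ?xu.
Qed.

Let V_down x y : x <= y -> y \in V -> x \in V.
Proof. by move=> xy /VP[u uS [yu su]]; apply/VP; exists u; rewrite ?(le_trans xy). Qed.

Let join x := glb (finset (fun u => [&& u \in S, x <= u & s <= u])).

Let joinP x : x \in S -> x \in V -> [/\ join x \in S, x <= join x, s <= join x &
  forall u, u \in S -> x <= u -> s <= u -> join x <= u].
Proof.
move=> xS /VP[u0 u0S [xu0 su0]].
have [||||jS jF lj] := @glbP (finset (fun u => [&& u \in S, x <= u & s <= u])) x u0.
- by apply/fintype.subsetP => u; rewrite inE => /and3P[].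
- by rewrite inE u0S xu0.
- by [].
- by move=> u; rewrite inE => /and3P[].
split=> //.
- by apply: lj => // u; rewrite inE => /and3P[].
- by apply: lj => // u; rewrite inE => /and3P[].
- by move=> u uS xu su; apply: jF; rewrite inE uS xu.
Qed.

Let join_mono x y : x \in S -> y \in S -> y \in V -> x <= y -> join x <= join y.
Proof.
move=> xS yS yV xy; have [jS yj sj _] := joinP yS yV.
have [_ _ _] := joinP xS (V_down xy yV); apply=> //.
exact: le_trans yj.
Qed.

Let top (c : {set P}) := odflt s [pick x in c | [forall y in c, y <= x]].

Let chainV c : chain S c -> c :&: V != finset.set0 -> chain S (c :&: V).
Proof.
move=> /chainP[_ cS cc] c0; apply/chainP; split=> // [p|p q].
  by rewrite inE => /andP[/cS].
by rewrite !inE => /andP[pc _] /andP[qc _]; exact: cc.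
Qed.

Let topP c : chain S c -> [/\ top c \in c, top c \in S & forall y, y \in c -> y <= top c].
Proof.
move=> /chainP[/set0Pn[p0 p0c] cS cc]; rewrite /top; case: pickP => [x /=|no].
  by move=> /andP[xc /forall_inP cx]; split=> //; exact: cS.
(* an element of c with the most elements of c below it is the greatest *)
pose below p : {set P} := finset (fun q => (q \in c) && (q <= p)).
pose m := [arg max_(p > p0 in c) #|below p|]%N.
have [mc mP] : m \in c /\ forall p, p \in c -> (#|below p| <= #|below m|)%N.
  by rewrite /m; case: arg_maxnP.
have /negP[] := negbT (no m); rewrite mc /=; apply/forall_inP => y yc.
have /orP[//|my] : (y <= m) || (m <= y) by exact: cc.
have mSy : below m \subset below y.
  apply/fintype.subsetP => q; rewrite !inE => /andP[-> /=] /le_trans; exact.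
have /eqP e : below m == below y by rewrite eqEcard mSy mP.
have : y \in below y by rewrite inE yc lexx.
by rewrite -e inE => /andP[].
Qed.

Let top_mono c c' : chain S c -> chain S c' -> c \subset c' -> top c <= top c'.
Proof.
move=> cc cc' /fintype.subsetP cS; have [tc _ _] := topP cc.
by have [_ _] := topP cc'; apply; exact: cS.
Qed.

(** A deformation of the subdivision into V. The map of S that fixes V and
    sends y outside of V to its meet with s is not monotone: for x <= y with x
    in V, x need not lie below that meet. But both lie below the meet of x v s
    and y, and the subdivision has a vertex for the pair of x and y to be sent
    there. *)
Let retract (c : {set P}) :=
  if top c \in V then top c else
  if c :&: V == finset.set0 then glb [set s; top c]%SET
  else glb [set join (top (c :&: V)); top c]%SET.

Let low y : y \in S -> y \notin V -> exists2 l, l \in S & l <= s /\ l <= y.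
Proof.
move=> yS yV; have [/VP|[l lS [ly ls]]] := no_complement yS; first by rewrite (negbTE yV).
by exists l.
Qed.

Let retractV c : chain S c -> [/\ retract c \in S, retract c \in V & retract c <= top c].
Proof.
move=> cc; have [_ tS _] := topP cc; rewrite /retract; case: ifP => [tV//|/negbT tV].
case: ifP => [_|/negbT c0].
  have [l lS [ls lt]] := low tS tV.
  have [gS gs gt _] := glb2P sS tS lS ls lt; split=> //.
  by apply/VP; exists s.
have ccV := chainV cc c0; have [xcV xS _] := topP ccV.
have /finset.setIP[_ xV] := xcV; have [jS xj sj _] := joinP xS xV.
have xt : top (c :&: V) <= top c by apply: top_mono => //; exact: subsetIl.
have [gS gj gt _] := glb2P jS tS xS xj xt; split=> //.
by apply/VP; exists (join (top (c :&: V))).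
Qed.

Let retract_chain_map : chain_map S retract.
Proof.
split=> [c /retractV[]//|c c' cc cc' cS].
have tt := top_mono cc cc' cS.
have [_ tS _] := topP cc; have [_ tS' _] := topP cc'.
have [rS rV rt] := retractV cc.
rewrite {2}/retract; case: ifP => [_|/negbT tV']; first exact: le_trans tt.
have [l lS [ls lt]] := low tS' tV'.
case: ifP => [/eqP c0'|/negbT c0'].
  have [_ _ _] := glb2P sS tS' lS ls lt; apply=> //; last exact: le_trans tt.
  have c0 : c :&: V == finset.set0.
    by rewrite -finset.subset0 -c0'; exact: finset.setSI.
  have tV : top c \notin V.
    apply/negP => tV; have [tc _ _] := topP cc.
    by move/eqP/setP/(_ (top c)): c0; rewrite finset.in_setI tc tV inE.
  rewrite /retract (negbTE tV) c0.
  have [l' l'S [l's l't]] := low tS tV.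
  by have [] := glb2P sS tS l'S l's l't.
have ccV := chainV cc' c0'; have [xcV xS xtop] := topP ccV.
have /finset.setIP[_ xV] := xcV; have [jS xj sj _] := joinP xS xV.
have xt : top (c' :&: V) <= top c' by apply: top_mono => //; exact: subsetIl.
have [_ _ _] := glb2P jS tS' xS xj xt; apply=> //; last exact: le_trans tt.
have [tc _ _] := topP cc.
rewrite /retract; case: ifP => [tV|/negbT tV].
  apply: le_trans xj; apply: xtop; rewrite inE tV andbT.
  exact: (fintype.subsetP cS).
case: ifP => [_|/negbT c0].
  have [l' l'S [l's l't]] := low tS tV.
  have [_ gs _ _] := glb2P sS tS l'S l's l't; exact: le_trans sj.
have ccV0 := chainV cc c0; have [xcV0 xS0 _] := topP ccV0.
have /finset.setIP[_ xV0] := xcV0; have [jS0 xj0 sj0 _] := joinP xS0 xV0.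
have xt0 : top (c :&: V) <= top c by apply: top_mono => //; exact: subsetIl.
have [_ gj _ _] := glb2P jS0 tS xS0 xj0 xt0; apply: le_trans gj _.
by apply: join_mono => //; apply: top_mono => //; exact: finset.setSI.
Qed.

(** The identity is induced up to homotopy by top, and
    top >= retract <= retract v s >= s. *)
Lemma noncomplemented_null_homotopic (X : topologicalType) (f : X -> P -> R) :
  weight_map S f -> exists2 w, weight S w & weight_homotopic S f (fun=> w).
Proof.
move=> wf.
have top_cm : chain_map S top.
  by split=> [c /topP[]//|]; exact: top_mono.
have join_cm : chain_map S (join \o retract).
  split=> [c /retractV[rS rV _]|c c' cc cc' cS] /=; first by have [] := joinP rS rV.
  have [rS _ _] := retractV cc; have [rS' rV' _] := retractV cc'.
  by apply: join_mono => //; exact: retract_chain_map.2.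
have s_cm : chain_map S (fun=> s) by split.
have ws : weight S (fun p => (p == s)%:R : R).
  split=> [p||p|p q].
  - exact: ler0n.
  - by rewrite (bigD1 s) //= eqxx big1 ?addr0 // => p /negbTE ->.
  - by have [->|_] := eqVneq p s; rewrite ?sS // eqxx.
  - have [->|_] := eqVneq p s; last by rewrite eqxx.
    by have [->|_] := eqVneq q s; rewrite ?eqxx // comparablexx.
exists (fun p => (p == s)%:R) => //.
have <- : push f (fun=> s) = fun=> (fun p => (p == s)%:R).
  apply/funext => x; apply/funext => p; rewrite /push eq_sym.
  case: eqP => _; last by rewrite big_pred0.
  exact: sum_flag_weight (wf.2 x).
apply: (weight_homotopic_trans (g := push f top)).
  by apply: push_homotopic_id => // c /topP[].
apply: (weight_homotopic_trans (g := push f retract)).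
  apply: weight_homotopic_sym; apply: push_homotopic_le => // c.
  by move=> /retractV[].
apply: (weight_homotopic_trans (g := push f (join \o retract))).
  apply: push_homotopic_le => // c /retractV[rS rV _] /=.
  by have [] := joinP rS rV.
apply: weight_homotopic_sym; apply: push_homotopic_le => // c /retractV[rS rV _] /=.
by have [] := joinP rS rV.
Qed.
End Contraction.

(** * Partitions as equivalence relations *)

Section PartitionRelation.
Variable A : finType.
Implicit Types l m : proper_partition A.

Definition same_block l a b : bool :=
  finset.pblock (blocks l) a == finset.pblock (blocks l) b.

Let cover_l l a : a \in finset.cover (blocks l).
Proof. by have /and3P[/finset.cover_partition -> _ _] := blocksP l; rewrite inE. Qed.

Let triv_l l : finset.trivIset (blocks l).
Proof. by have /and3P[/finset.partition_trivIset + _ _] := blocksP l. Qed.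

Lemma mem_pblock_same l a b : (b \in finset.pblock (blocks l) a) = same_block l a b.
Proof. by rewrite /same_block finset.eq_pblock. Qed.

Lemma pblock_block l a : finset.pblock (blocks l) a \in blocks l.
Proof. exact: finset.pblock_mem. Qed.

Lemma block_nonempty l B : B \in blocks l -> exists a, a \in B.
Proof.
by have /and3P[pl _ _] := blocksP l; move=> /(finset.partition_neq0 pl)/set0Pn.
Qed.

Lemma block_pblock l B a : B \in blocks l -> a \in B -> finset.pblock (blocks l) a = B.
Proof. exact: finset.def_pblock. Qed.

Lemma le_same_blockP l m :
  reflect (forall a b, same_block l a b -> same_block m a b) (l <= m)%O.
Proof.
apply: (iffP (coarseningP l m)) => [lm a b ab|lm B Bl].
  have [C Cm /fintype.subsetP sC] := lm _ (pblock_block l a).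
  have aC : a \in C by apply: sC; rewrite mem_pblock_same /same_block.
  have bC : b \in C by apply: sC; rewrite mem_pblock_same.
  by rewrite /same_block (block_pblock Cm aC) (block_pblock Cm bC).
have [a aB] := block_nonempty Bl.
exists (finset.pblock (blocks m) a); first exact: pblock_block.
rewrite -(block_pblock Bl aB); apply/fintype.subsetP => b.
by rewrite !mem_pblock_same; exact: lm.
Qed.

Lemma same_block_inj l m : same_block l =2 same_block m -> l = m.
Proof.
by move=> lm; apply/le_anti/andP; split; apply/le_same_blockP => a b; rewrite lm.
Qed.

Lemma exists_same_block l : exists a b, a != b /\ same_block l a b.
Proof.
have /and3P[_ /forall_inPn[B Bl B1] _] := blocksP l.
have [a aB] := block_nonempty Bl.
have /fintype.subsetPn[b bB ba] : ~~ (B \subset [set a]%SET).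
  apply: contra B1 => sB; rewrite eqn_leq (leq_trans (subset_leq_card sB)) ?cards1 //.
  by rewrite card_gt0; apply/set0Pn; exists a.
exists b, a; split; first by rewrite inE in ba.
by rewrite /same_block (block_pblock Bl aB) (block_pblock Bl bB).
Qed.

Lemma exists_not_same_block l : exists a b, ~~ same_block l a b.
Proof.
have /and3P[_ _ l1] := blocksP l; apply: contrapT => no.
have [a [b [_ _]]] := exists_same_block l.
case/negP: l1; apply/cards1P; exists (finset.pblock (blocks l) a).
apply/setP => B; rewrite inE; apply/idP/eqP => [Bl|->]; last exact: pblock_block.
have [c cB] := block_nonempty Bl; rewrite -(block_pblock Bl cB).
by apply/eqP; apply: contrapT => /negP nac; apply: no; exists c, a.
Qed.

Lemma partition_of_map (T : eqType) (q : A -> T) a b a' b' :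
  a != b -> q a = q b -> q a' != q b' ->
  exists l, forall x y, same_block l x y = (q x == q y).
Proof.
move=> ab qab qab'; pose p := preim_partition q [set: A].
have pE x y : (y \in finset.pblock p x) = (q x == q y).
  rewrite finset.pblock_equivalence_partition ?inE // => u v w _ _ _.
  by split=> [//|/eqP ->].
have pP := preim_partitionP q [set: A].
have cov x : x \in finset.cover p by rewrite (finset.cover_partition pP) inE.
have ok : proper_partition_pred p.
  apply/and3P; split=> //.
    apply/forall_inPn; exists (finset.pblock p a); first exact: finset.pblock_mem.
    apply/cards1P => -[c pc].
    have : a \in finset.pblock p a by rewrite pE.
    have : b \in finset.pblock p a by rewrite pE qab.
    by rewrite pc !inE => /eqP bc /eqP ac; rewrite ac bc eqxx in ab.
  apply/cards1P => -[B pB].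
  have inB x : finset.pblock p x = B.
    by have := finset.pblock_mem (cov x); rewrite pB inE => /eqP.
  by move: qab'; rewrite -pE inB -(inB b') pE eqxx.
exists (ProperPartition ok) => x y.
by rewrite -mem_pblock_same -pE.
Qed.
End PartitionRelation.

(** * Invariant partitions *)

Section FixedPartitions.
Variables (gT : finGroupType) (G H : {group gT}) (sHG : H \subset G).
Variables (A : finType) (to : action G A).
Implicit Types l m : proper_partition A.

Lemma same_block_act l g a b : g \in G ->
  same_block (proper_partition_act to g l) (to a g) (to b g) = same_block l a b.
Proof.
move=> gG; have injg : injective (to^~ g) by exact: act_inj.
have pE x : finset.pblock (blocks (proper_partition_act to g l)) (to x g) =
    [set to y g | y in finset.pblock (blocks l) x]%SET.
  apply: block_pblock; first by apply: imset_f; exact: pblock_block.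
  by apply: imset_f; rewrite mem_pblock_same /same_block.
by rewrite /same_block !pE (inj_eq (imset_inj injg)).
Qed.

Definition fixed_partitions : {set proper_partition A} :=
  finset (fun l => [forall h in H, proper_partition_act to h l == l]).

Lemma fixed_partitionsP l :
  reflect (forall h a b, h \in H -> same_block l (to a h) (to b h) = same_block l a b)
          (l \in fixed_partitions).
Proof.
rewrite inE; apply: (iffP forall_inP) => [fl h a b hH|fl h hH].
  by rewrite -[in LHS](eqP (fl h hH)) same_block_act // (fintype.subsetP sHG).
have hG := fintype.subsetP sHG h hH.
apply/eqP; apply: same_block_inj => a b.
by rewrite -[a](actKVin to hG) -[b](actKVin to hG) same_block_act // (fl h).
Qed.

(** A partition and its translate have equally many pairs of elements in a
    common block, so neither can be strictly coarser. *)
Lemma comparable_act_fixed l g : g \in G ->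
  (l >=< proper_partition_act to g l)%O -> proper_partition_act to g l = l.
Proof.
move=> gG; pose pairs k : {set A * A} := finset (fun ab => same_block k ab.1 ab.2).
have pairs_le k m : (k <= m)%O -> #|pairs k| = #|pairs m| -> k = m.
  move=> /le_same_blockP lm c.
  have /eqP e : pairs k == pairs m.
    rewrite eqEcard c leqnn andbT; apply/fintype.subsetP => ab.
    by rewrite !inE; exact: lm.
  by apply: same_block_inj => a b; move/setP/(_ (a, b)): e; rewrite !inE.
have cardE : #|pairs (proper_partition_act to g l)| = #|pairs l|.
  have inj2 : injective (fun ab : A * A => (to ab.1 g, to ab.2 g)).
    by move=> [a b] [c e] /= [/act_inj -> /act_inj ->].
  rewrite -[RHS](card_imset _ inj2); apply: eq_card => -[a b]; rewrite inE /=.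
  apply/idP/imsetP => [ab|[[c e] + [-> ->]]].
    exists (to a g^-1%g, to b g^-1%g); rewrite ?actKVin // inE /=.
    by rewrite -(same_block_act _ _ _ gG) !actKVin.
  by rewrite inE /= same_block_act.
by move=> /orP[] /pairs_le; [move=> <-|move=> ->].
Qed.

(** The infimum is the partition by the family of all blocks containing an
    element. A lower bound keeps it from being discrete, a member of F from
    being indiscrete. *)
Lemma fixed_partitions_glb (F : {set proper_partition A}) l f :
  F \subset fixed_partitions -> f \in F -> l \in fixed_partitions ->
  (forall f, f \in F -> (l <= f)%O) -> exists g, is_glb fixed_partitions F g.
Proof.
move=> /fintype.subsetP FS fF lS lF.
pose q a := [ffun u : proper_partition A =>
  if u \in F then finset.pblock (blocks u) a else finset.set0].
have qP a b : reflect (forall u, u \in F -> same_block u a b) (q a == q b).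
  apply: (iffP eqP) => [/ffunP qab u uF|qab].
    by have := qab u; rewrite !ffunE uF => /eqP.
  by apply/ffunP => u; rewrite !ffunE; case: ifP => // /qab /eqP.
have [a [b [ab lab]]] := exists_same_block l.
have [a' [b' fab']] := exists_not_same_block f.
have [||g gE] := @partition_of_map A _ q a b a' b' ab.
- by apply/eqP/qP => u /lF/le_same_blockP; apply.
- by apply: contra fab' => /qP; apply.
exists g; apply/and3P; split.
- apply/fixed_partitionsP => h x y hH; rewrite !gE; apply/qP/qP => xy u uF.
    by have /fixed_partitionsP uS := FS u uF; rewrite -(uS h) // xy.
  by have /fixed_partitionsP uS := FS u uF; rewrite uS // xy.
- by apply/forall_inP => u uF; apply/le_same_blockP => x y; rewrite gE => /qP; apply.
- apply/forall_inP => m mS; apply/implyP => /forall_inP mF.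
  apply/le_same_blockP => x y mxy; rewrite gE; apply/qP => u /mF/le_same_blockP.
  exact.
Qed.

(** The hypotheses say that the quotient of A by q is a transitive H-set to
    which every orbit of A maps isomorphically. With K the stabiliser of the
    class of a0, a point a corresponds to the coset of those h that move the
    class of a0 to that of a, together with the point of the class of a0 in the
    orbit of a. *)
Lemma copies_of_orbit_of_map (T : eqType) (q : A -> T) :
  (forall h a b, h \in H -> q a = q b -> q (to a h) = q (to b h)) ->
  (forall h a, h \in H -> q (to a h) = q a -> to a h = a) ->
  (forall a b, exists2 h, h \in H & q (to a h) = q b) ->
  exists (K : {group gT}) (n : nat),
    K \subset H /\ copies_of_orbit (to \ sHG)%act n K.
Proof.
move=> q_equiv q_free q_trans.
have toM a : {in H &, act_morph to a}.
  by move=> g h gH hH; apply: actMin; exact: (fintype.subsetP sHG).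
have toK h a : h \in H -> to (to a h) h^-1%g = a.
  by move=> hH; rewrite actKin // (fintype.subsetP sHG).
have [[a0 _]|noA] := pselect (exists a : A, True); last first.
  exists H, 0%N; split=> //.
  exists (fun a => False_rect _ (noA (ex_intro _ a I))); split.
    have no0 (i : 'I_0) : False by case: i.
    exists (fun y => False_rect A (no0 y.1)) => [a|[i C]]; last by case: (no0 i).
    by case: noA; exists a.
  by move=> a; case: noA; exists a.
pose fiber a : {set gT} := finset (fun h => (h \in H) && (q (to a0 h) == q a)).
have fiberP h a : reflect (h \in H /\ q (to a0 h) = q a) (h \in fiber a).
  by rewrite inE; apply: (iffP andP) => -[hH /eqP].
have K_group : group_set (fiber a0).
  apply/group_setP; split=> [|g h /fiberP[gH gq] /fiberP[hH hq]].
    by apply/fiberP; rewrite act1.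
  by apply/fiberP; rewrite groupM // toM // (q_equiv h _ a0).
pose K := Group K_group; exists K.
have fiberE h a : h \in fiber a -> fiber a = (K :* h)%g.
  move=> /fiberP[hH hq]; apply/setP => g; rewrite mem_rcoset.
  apply/fiberP/fiberP => [[gH gq]|[ghH ghq]].
    rewrite groupM ?groupV // toM ?groupV //; split=> //.
    by rewrite -[in RHS](toK h a0 hH); apply: q_equiv; rewrite ?groupV // gq hq.
  have gH : g \in H by rewrite -(mulgKV h g) groupM.
  split=> //; rewrite -hq -(mulgKV h g) toM //.
  exact: q_equiv.
have fiber_coset a : fiber a \in rcosets K H.
  have [h hH hq] := q_trans a0 a.
  apply/rcosetsP; exists h => //; apply: fiberE.
  by apply/fiberP.
pose F : {set A} := finset (fun a => q a == q a0).
have a0F : a0 \in F by rewrite inE.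
pose base a := to a (repr (fiber a))^-1%g.
have fiber_repr a : repr (fiber a) \in fiber a.
  by have [h hH hq] := q_trans a0 a; apply: (mem_repr h); apply/fiberP.
have q_base a h : h \in fiber a -> q (to a h^-1%g) = q a0.
  move=> /fiberP[hH hq]; rewrite -[in RHS](toK h a0 hH).
  by apply: q_equiv; rewrite ?groupV.
have baseE a h : h \in fiber a -> base a = to a h^-1%g.
  move=> hf; have := fiber_repr a; rewrite /base; set g := repr _ => gf.
  have /fiberP[gH _] := gf; have /fiberP[hH _] := hf.
  have e : to (to a h^-1%g) (h * g^-1)%g = to a g^-1%g.
    by rewrite -toM ?groupM ?groupV // mulKg.
  rewrite -e; apply: q_free; first by rewrite groupM ?groupV.
  by rewrite e !q_base.
have baseF a : base a \in F by rewrite inE /base q_base.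
exists #|F|; split; first by apply/fintype.subsetP => h /fiberP[].
have fiber_act a h : h \in H -> fiber (to a h) = (fiber a :* h)%g.
  move=> hH; have := fiber_repr a; set g := repr _ => gf.
  rewrite (fiberE g a) // -rcosetM; apply: fiberE.
  have /fiberP[gH gq] := gf; apply/fiberP; rewrite groupM // toM //; split=> //.
  exact: q_equiv.
pose f a : 'I_#|F| * {C : {set gT} | C \in rcosets K H} :=
  (enum_rank_in a0F (base a), exist (fun C => C \in rcosets K H) _ (fiber_coset a)).
exists f; split=> [|a h hH]; last first.
  split; last exact: fiber_act.
  rewrite /=; congr (enum_rank_in _ _).
  have gf := fiber_repr a; have /fiberP[gH _] := gf.
  rewrite (baseE _ (repr (fiber a) * h)%g); last first.
    by rewrite fiber_act // mem_rcoset mulgK.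
  by rewrite invMg toM ?groupV // toK.
have f_inj : injective f.
  move=> a b [] /(congr1 enum_val); rewrite !enum_rankK_in // => ab fab.
  have := fiber_repr a; set g := repr _ => gf.
  have gf' := gf; rewrite fab in gf'.
  move: ab; rewrite (baseE a _ gf) (baseE b _ gf'); exact: act_inj.
have f_surj y : exists a, f a = y.
  case: y => i [C CK]; have /rcosetsP[h hH CE] := CK.
  have rF := enum_valP i; set r := enum_val i in rF.
  have rq : q r = q a0 by move: rF; rewrite inE => /eqP.
  have hf : h \in fiber (to r h).
    by apply/fiberP; split=> //; apply: q_equiv.
  exists (to r h); congr pair.
    by rewrite (baseE _ h) // toK // enum_valK_in.
  by apply: val_inj; rewrite /= (fiberE h) // CE.
have /choice[g gK] := f_surj; exists g => // a.
by apply: f_inj; rewrite gK.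
Qed.

(** The element s is the partition into orbits. A complement y would meet every
    orbit in single points and have the transitive quotient A/y, so that all
    orbits would be isomorphic to A/y. *)
Lemma orbit_partition_no_complement :
  (forall (K : {group gT}) n, K \subset H -> ~ copies_of_orbit (to \ sHG)%act n K) ->
  exists2 s, s \in fixed_partitions & forall y, y \in fixed_partitions ->
    (exists2 u, u \in fixed_partitions & (y <= u)%O /\ (s <= u)%O) \/
    (exists2 l, l \in fixed_partitions & (l <= y)%O /\ (l <= s)%O).
Proof.
move=> noK.
have no_map (T : eqType) (q : A -> T) :
  (forall h a b, h \in H -> q a = q b -> q (to a h) = q (to b h)) ->
  (forall h a, h \in H -> q (to a h) = q a -> to a h = a) ->
  ~ (forall a b, exists2 h, h \in H & q (to a h) = q b).
  by move=> q1 q2 q3; have [K [n [KH]]] := copies_of_orbit_of_map q1 q2 q3; exact: noK.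
have orbitH h a : h \in H -> orbit to H (to a h) = orbit to H a.
  by move=> hH; apply: orbit_act_in.
have orbit_rel a b : orbit to H a = orbit to H b -> exists2 h, h \in H & to a h = b.
  by move=> e; apply/orbitP; rewrite e; exact: orbit_refl.
(* If H acted trivially, the map to a point would exhibit A as copies of H/H;
   hence s is not discrete. *)
have [h0 [a0 [h0H ha0]]] : exists h a, h \in H /\ to a h != a.
  apply: contrapT => no; apply: (no_map _ (fun=> tt)) => // [h a hH _|]; last first.
    by exists 1%g.
  by apply: contrapT => /eqP ha; apply: no; exists h, a.
(* If H acted transitively, the identity would exhibit A as a single orbit;
   hence s is not indiscrete. *)
have [a1 [b1 ab1]] : exists a b, orbit to H a != orbit to H b.
  apply: contrapT => no; apply: (no_map _ id) => // [h a b _ -> //|a b].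
  by apply: orbit_rel; apply: contrapT => /eqP ab; apply: no; exists a, b.
have [s sE] := partition_of_map ha0 (orbitH _ _ h0H) ab1.
exists s.
  by apply/fixed_partitionsP => h a b hH; rewrite !sE !orbitH.
move=> y /fixed_partitionsP yH.
pose q a := finset.pblock (blocks y) a.
have qE a b : (q a == q b) = same_block y a b by [].
have [ab|free] := pselect (exists h a, [/\ h \in H, same_block y (to a h) a & to a h != a]).
  right; have [h [a [hH ya ha]]] := ab.
  have [c [e yce]] := exists_not_same_block y.
  have [||l lE] := @partition_of_map A _ (fun x => (q x, orbit to H x)) _ _ c e ha.
  - by rewrite orbitH // (eqP (_ : q (to a h) == q a)).
  - by apply: contra yce => /eqP[/eqP].
  exists l.
    by apply/fixed_partitionsP => g x z gH; rewrite !lE !xpair_eqE !qE yH // !orbitH.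
  by split; apply/le_same_blockP => x z; rewrite lE xpair_eqE => /andP[]; rewrite ?sE.
left.
(* The join of y with s: the partition by the H-orbit of the block. *)
pose j a : {set {set A}} := [set q (to a h) | h in H]%SET.
have q_act h a b : h \in H -> q a = q b -> q (to a h) = q (to b h).
  by move=> hH /eqP ab; apply/eqP; rewrite qE yH.
have j_act h a : h \in H -> j (to a h) = j a.
  move=> hH; apply/setP => B; apply/imsetP/imsetP => -[g gH ->].
    exists (h * g)%g; first by rewrite groupM.
    by rewrite actMin ?(fintype.subsetP sHG).
  exists (h^-1 * g)%g; first by rewrite groupM ?groupV.
  by rewrite -actMin ?mulKVg ?groupM ?groupV ?(fintype.subsetP sHG).
have j_q a b : q a = q b -> j a = j b.
  by move=> ab; apply: eq_in_imset => h hH; exact: q_act.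
have [[a [b ab]]|trans] := pselect (exists a b, j a != j b).
  have [||u uE] := @partition_of_map A _ j _ _ a b ha0 => //.
    by rewrite j_act.
  exists u; first by apply/fixed_partitionsP => h x z hH; rewrite !uE !j_act.
  split; apply/le_same_blockP => x z.
    by rewrite uE -qE => /eqP/j_q ->.
  by rewrite sE uE => /eqP/orbit_rel[h hH <-]; rewrite j_act.
case: (no_map _ q q_act).
  move=> h a hH /eqP; rewrite qE => ya; apply: contrapT => /eqP ha.
  by apply: free; exists h, a.
move=> a b; have /eqP jab : j a == j b.
  by apply: contrapT => /negP ab; apply: trans; exists a, b.
have : q b \in j b by apply/imsetP; exists 1%g; rewrite ?act1.
by rewrite -jab => /imsetP[h hH ->]; exists h.
Qed.
End FixedPartitions.

(** * The fixed points of the realization *)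

Lemma coords_realization_map (R : realType) (d : Order.disp_t)
    (P : finPOrderType d) (f : P -> P) (f_mono : {homo f : x y / (x <= y)%O})
    (x : realization R P) p :
  injective f -> coords id (realization_map f_mono x) (f p) = coords id x p.
Proof.
move=> f_inj; rewrite -(of_realizationK x) realization_mapE !coordsE.
by apply: eq_bigl => i; rewrite /= ffunE (inj_eq f_inj).
Qed.

Lemma subspace_corestrict (X Y : topologicalType) (S : set Y) (f : X -> Y) :
  (forall x, S (f x)) -> continuous f ->
  exists2 g : X -> S, continuous g & forall x, set_val (g x) = f x.
Proof.
move=> Sf cf.
exists (fun x => exist (fun y => y \in S) (f x) (mem_set (Sf x))).
  exact: (@continuous_comp_initial _ _ _ (@set_val _ S)).
by move=> x; rewrite set_valE.
Qed.

Section FixedRealization.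
Variables (R : realType) (gT : finGroupType) (G H : {group gT}).
Hypothesis sHG : H \subset G.
Variables (A : finType) (to : action G A).
Let P := proper_partition A.
Let S : {set P} := fixed_partitions H to.

Let id_image (p : P) : p \in [set: P]%SET <-> exists x, id x = p.
Proof. by split=> [_|_]; [exists p|rewrite inE]. Qed.

(** The support of a fixed point is an H-invariant chain, and a partition is
    comparable to a translate only if it is equal to it. *)
Lemma fixed_realizationP (x : realization R P) :
  (forall h, h \in H -> realization_map (@proper_partition_act_mono _ _ _ to h) x = x) <->
  weight S (coords id x).
Proof.
have act_inj_P h : h \in H -> injective (proper_partition_act to h).
  move=> hH l m lm; apply: same_block_inj => a b.
  have hG := fintype.subsetP sHG h hH.
  by rewrite -(same_block_act to l a b hG) lm same_block_act.
have [w0 w1 _ wc] := @coords_weight R _ _ P P id (fun _ _ => erefl) _ id_image x.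
split=> [fx|[_ _ wS _] h hH].
  split=> // l wl; rewrite inE; apply/forall_inP => h hH; apply/eqP.
  apply: (comparable_act_fixed (fintype.subsetP sHG h hH)); apply: wc => //.
  by rewrite -(fx h hH) coords_realization_map //; exact: act_inj_P.
have injh := act_inj_P h hH.
apply: (coords_inj (fun _ _ => erefl) id_image); apply/funext => p.
have [l <-] : exists l, proper_partition_act to h l = p.
  by exists (invF injh p); rewrite f_invF.
rewrite coords_realization_map //.
have fixE m : coords id x m != 0 -> proper_partition_act to h m = m.
  by move=> /wS; rewrite inE => /forall_inP/(_ h hH)/eqP.
have [/fixE -> //|/negbNE/eqP l0] := boolP (coords id x l != 0).
rewrite l0; apply/esym/eqP; apply: contraT => hl.
by have := hl; rewrite (injh _ _ (fixE _ hl)) l0 eqxx.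
Qed.

Lemma fixed_realization_lift (X : topologicalType) (f : X -> P -> R) :
  weight_map S f ->
  exists2 g : X -> fixed_realization R to H,
    continuous g & forall x, coords id (set_val (g x)) = f x.
Proof.
move=> [cf wf].
have wT x : weight [set: P]%SET (f x).
  by have [w0 w1 _ wc] := wf x; split=> // p; rewrite inE.
have /choice[e eE] x := coords_surj (fun _ _ => erefl) id_image (wT x).
have ce : continuous e.
  apply: (coords_initial (fun _ _ => erefl) id_image) => p.
  by rewrite (_ : (fun _ => _) = f^~ p) //; apply/funext => x; rewrite eE.
have e_fixed x : [set y : realization R P | forall h, h \in H ->
    realization_map (@proper_partition_act_mono _ _ _ to h) y = y] (e x).
  by apply/fixed_realizationP; rewrite eE.
have [g cg gE] := subspace_corestrict e_fixed ce.
by exists g => // x; rewrite gE eE.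
Qed.

Lemma fixed_realization_coords :
  weight_map S (fun x : fixed_realization R to H => coords id (set_val x)).
Proof.
split=> [p x|x].
  apply: (@continuous_comp _ _ _ set_val (fun y => coords id y p)).
    exact: initial_continuous.
  exact: coords_continuous.
apply/fixed_realizationP.
by have := valP x; rewrite set_valE => /set_mem.
Qed.

Lemma fixed_realization_coords_inj (x y : fixed_realization R to H) :
  coords id (set_val x) = coords id (set_val y) -> x = y.
Proof.
by move/(coords_inj (fun _ _ => erefl) id_image); rewrite set_valE => /val_inj.
Qed.

Lemma fixed_realization_contractible s :
  s \in S ->
  (forall y, y \in S ->
    (exists2 u, u \in S & (y <= u)%O /\ (s <= u)%O) \/
    (exists2 l, l \in S & (l <= y)%O /\ (l <= s)%O)) ->
  contractible R (fixed_realization R to H).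
Proof.
move=> sS nc.
have [w Sw [F [wF F0 F1]]] := noncomplemented_null_homotopic sS
  (@fixed_partitions_glb _ _ _ sHG _ to) nc fixed_realization_coords.
have [g cg gE] := fixed_realization_lift wF.
have [|e _ eE] := @fixed_realization_lift R (fun=> w).
  by split=> // p; exact: cst_continuous.
exists (e 0), g; split.
- exact: continuous_subspaceT.
- by move=> x; apply: fixed_realization_coords_inj; rewrite gE F0.
- by move=> x; apply: fixed_realization_coords_inj; rewrite gE F1 eE.
Qed.

Lemma homotopic_refl (X Y : topologicalType) (f g : X -> Y) :
  continuous f -> f =1 g -> homotopic R f g.
Proof.
move=> cf fg; exists (f \o fst); split=> //.
by apply: continuous_subspaceT => x; apply: continuous_comp; [exact: cvg_fst|exact: cf].
Qed.

Lemma fixed_realization_embedding (d : Order.disp_t) (Q : porderType d)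
    (j : Q -> P) :
  (forall x y, (j x <= j y)%O = (x <= y)%O) ->
  (forall p, p \in S <-> exists x, j x = p) ->
  homotopy_equivalent R (fixed_realization R to H) (realization R Q).
Proof.
move=> j_emb jS.
have wj : weight_map S (coords j : realization R Q -> P -> R).
  by split=> [p|x]; [exact: coords_continuous|exact: coords_weight].
have [g cg gE] := fixed_realization_lift wj.
have [cf wf] := fixed_realization_coords.
have /choice[f fE] x := coords_surj j_emb jS (wf x).
have cf' : continuous f.
  apply: (coords_initial j_emb jS) => p.
  rewrite (_ : (fun _ => _) = fun x => coords id (set_val x) p) //.
  by apply/funext => x; rewrite fE.
exists f, g; split=> //.
- apply: homotopic_refl => [x|x].
    by apply: continuous_comp; [exact: cf'|exact: cg].
  by apply: fixed_realization_coords_inj; rewrite /= gE fE.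
- apply: homotopic_refl => [x|x].
    by apply: continuous_comp; [exact: cg|exact: cf'].
  by apply: (coords_inj j_emb jS); rewrite /= fE gE.
Qed.
End FixedRealization.

(** * Equivariant surjections as invariant partitions *)

Section EquivariantQuotients.
Variables (gT : finGroupType) (G H : {group gT}) (sHG : H \subset G).
Variables (A : finType) (to : action G A).
Let toH := (to \ sHG)%act.
Let P := proper_partition A.

Lemma hs_factorP (q' q : hsurj toH) :
  hs_factor q' q <-> forall a b, hs_fun q' a = hs_fun q' b -> hs_fun q a = hs_fun q b.
Proof.
split=> [[f _ fq] a b ab|q'q]; first by rewrite !fq /= ab.
have /choice[s sK] := hs_surj (h := q').
exists (fun b => hs_fun q (s b)) => [b h hH|a].
  by rewrite -hs_equivariant //; apply: q'q; rewrite sK hs_equivariant // sK.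
by apply: q'q; rewrite sK.
Qed.

Lemma hsurj_partition (q : hsurj toH) :
  exists l : P, forall a b, same_block l a b = (hs_fun q a == hs_fun q b).
Proof.
have [a [b [ab qab]]] : exists a b, a != b /\ hs_fun q a = hs_fun q b.
  apply: contrapT => no; apply: (hs_not_iso (h := q)).
  have /choice[s sK] := hs_surj (h := q); exists s => // a.
  by apply: contrapT => /eqP ab; apply: no; exists (s (hs_fun q a)), a.
have [a' [b' ab']] : exists a' b', hs_fun q a' != hs_fun q b'.
  apply: contrapT => no; apply: (hs_not_point (h := q)).
  have qab' x y : hs_fun q x = hs_fun q y.
    by apply: contrapT => /eqP xy; apply: no; exists x, y.
  have b0 := hs_fun q a.
  apply/eqP; rewrite eqn_leq (leq_ltn_trans _ (ltn_ord b0)) // andbT.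
  rewrite -[hs_size q]card_ord; apply/card_le1_eqP => b1 b2 _ _.
  have [x <-] := hs_surj (h := q) b1; have [y <-] := hs_surj (h := q) b2.
  exact: qab'.
exact: partition_of_map ab qab ab'.
Qed.

(** The blocks of an invariant partition, numbered by ordinals, form an
    H-set. *)
Lemma fixed_partition_hsurj (l : P) : l \in fixed_partitions H to ->
  exists q : hsurj toH, forall a b, same_block l a b = (hs_fun q a == hs_fun q b).
Proof.
move=> /(fixed_partitionsP sHG) lH.
have [a0 [b0 [ab0 lab0]]] := exists_same_block l.
have [c0 [e0 lce0]] := exists_not_same_block l.
have lB a := pblock_block l a.
pose r a : 'I_#|blocks l| := enum_rank_in (lB a0) (finset.pblock (blocks l) a).
have rE a b : (r a == r b) = same_block l a b.
  by apply/eqP/eqP => [/(congr1 enum_val)|]; rewrite /r ?enum_rankK_in // => ->.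
have r_surj i : exists a, r a = i.
  have [a ai] := block_nonempty (enum_valP i); exists a.
  by rewrite /r (block_pblock (enum_valP i) ai) enum_valK_in.
have /choice[s sK] := r_surj.
(* An action consists of injective maps for all elements of gT, hence the
   identity outside of H. *)
pose act i h := if h \in H then r (to (s i) h) else i.
have actE a h : h \in H -> act (r a) h = r (to a h).
  by move=> hH; apply/eqP; rewrite /act hH rE lH // -rE sK.
have act_is_action : is_action H act.
  split=> [h i k|i g h gH hH]; last first.
    rewrite -(sK i) !actE ?groupM //.
    by rewrite actMin // (fintype.subsetP sHG).
  case: (boolP (h \in H)) => hH; last by rewrite /act (negbTE hH).
  rewrite -(sK i) -(sK k) !actE // => /eqP.
  by rewrite rE lH // -rE => /eqP.
have q_equiv : equivariant toH (Action act_is_action) r.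
  by move=> a h hH; rewrite /= actE.
have q_not_iso : ~ bijective r.
  move=> /bij_inj r_inj; move: ab0.
  by have /eqP/r_inj -> : r a0 == r b0; rewrite ?rE ?eqxx.
have q_not_point : #|blocks l| <> 1%N.
  move=> l1; move: lce0; rewrite -rE.
  have /card_le1_eqP le1 : (#|'I_#|blocks l| | <= 1)%N by rewrite card_ord l1.
  by rewrite (le1 (r c0) (r e0)) ?eqxx.
by exists (HSurj q_equiv r_surj q_not_iso q_not_point) => a b; rewrite rE.
Qed.

Lemma hpartition_embedding : exists j : hpartition toH -> P,
  (forall x y, (j x <= j y)%O = (x <= y)%O) /\
  (forall l, l \in fixed_partitions H to <-> exists x, j x = l).
Proof.
have /choice[j0 j0E] := hsurj_partition.
have /choice[r rK] := @hs_class_surj _ _ _ toH.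
have j_emb q' q : (j0 q' <= j0 q)%O = (hs_class q' <= hs_class q)%O.
  apply/le_same_blockP/idP => [q'q|/hpartition_leE/hs_factorP q'q a b].
    apply/hpartition_leE/hs_factorP => a b /eqP.
    by rewrite -j0E => /q'q; rewrite j0E => /eqP.
  by rewrite !j0E => /eqP/q'q ->.
exists (j0 \o r); split=> [x y|l]; first by rewrite /= j_emb !rK.
split=> [lS|[x <-]].
  have [q qE] := fixed_partition_hsurj lS; exists (hs_class q) => /=.
  have -> : l = j0 q by apply: same_block_inj => a b; rewrite qE j0E.
  by apply/le_anti; rewrite !j_emb rK lexx.
apply/(fixed_partitionsP sHG) => h a b hH; rewrite /= !j0E.
have e c : hs_fun (r x) (to c h) = hs_act (r x) (hs_fun (r x) c) h.
  exact: (@hs_equivariant _ _ _ _ (r x) c h hH).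
by rewrite !e (inj_eq (@act_inj _ _ _ _ h)).
Qed.
End EquivariantQuotients.

(** * The theorem *)

Theorem theorem1p2 (R : realType) (gT : finGroupType) (G H : {group gT})
    (sHG : H \subset G) (A : finType) (to : action G A) :
  homotopy_equivalent R (fixed_realization R to H)
                        (realization R (hpartition (to \ sHG)%act)) /\
  (~ contractible R (fixed_realization R to H) ->
   exists (K : {group gT}) (n : nat),
     K \subset H /\ copies_of_orbit (to \ sHG)%act n K).
Proof.
split.
  have [j [j_emb jS]] := hpartition_embedding sHG to.
  exact: fixed_realization_embedding j_emb jS.
move=> nc; apply: contrapT => no; apply: nc.
have [|s sS s_no_compl] :=
  @orbit_partition_no_complement _ _ _ sHG _ to.
  by move=> K n KH KA; apply: no; exists K, n.
exact: fixed_realization_contractible sS s_no_compl.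
Qed.
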